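(* Let $A\in\mathbb{R}^{n\times n}$, $B\in\mathbb{R}^{n\times m}$, $D=\Gamma\Gamma^{\top}$ with $\Gamma\in\mathbb{R}^{n\times r}$, $Q\in\mathbb{S}^n$ with $Q\succeq0$, $R\in\mathbb{S}^m$ with $R\succ0$, $\varpi=0$, and $\Sigma_0,\Sigma_{\rm f}\in\mathbb{S}^n_{++}$ with $\Sigma_0\neq\Sigma_{\rm f}$; assume $(A,B)$ is controllable and that the asymptotic point convergence assumption (defined in the context) holds. Assume that the Asymptotic Gateway $$\mathcal{G}_\infty=\left\{\Sigma\in\mathbb{S}^n_{++}:\ A\Sigma+\Sigma A^{\top}+D=0\ \text{and}\ \operatorname{tr}(Q\Sigma)=0\right\}$$ is nonempty. Then, as $t_{\rm f}\to+\infty$, the family $\{\Sigma_{t_{\rm f}}(\cdot)\}_{t_{\rm f}>0}$ of optimal covariance trajectories of the fixed-final-time problems admits an Asymptotic Connection (defined in the context), and the corresponding Hamiltonian converges to zero, $\lim_{t_{\rm f}\to+\infty}\mathrm{H}_{t_{\rm f}}=0$; that is, $t_{\rm f}=+\infty$ is an asymptotic Hamiltonian-zero.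
   Context: $\mathbb{S}^n$ denotes the real symmetric $n\times n$ matrices and $\mathbb{S}^n_{++}$ the positive-definite ones. Fixed-final-time covariance steering problem: for fixed $t_{\rm f}\in(0,+\infty)$, minimize over gains $K$ (piecewise continuous on compact intervals, with values in $\mathbb{R}^{m\times n}$) the cost $\tfrac12\int_0^{t_{\rm f}}\left(\varpi+\operatorname{tr}(Q\Sigma(t))+\operatorname{tr}(K(t)^{\top}RK(t)\Sigma(t))\right)dt$ subject to $\dot\Sigma=(A+BK)\Sigma+\Sigma(A+BK)^{\top}+D$, $\Sigma(0)=\Sigma_0$, $\Sigma(t_{\rm f})=\Sigma_{\rm f}$. It is known that for every $t_{\rm f}>0$ the boundary value problem $$\dot\Pi=-Q-A^{\top}\Pi-\Pi A+\Pi BR^{-1}B^{\top}\Pi,$$ $$\dot\Sigma=(A-BR^{-1}B^{\top}\Pi)\Sigma+\Sigma(A-BR^{-1}B^{\top}\Pi)^{\top}+D,\quad \Sigma(0)=\Sigma_0,\ \Sigma(t_{\rm f})=\Sigma_{\rm f}$$ ($\Pi(0),\Pi(t_{\rm f})$ free) has a unique solution on $[0,t_{\rm f}]$, denoted $(\Sigma_{t_{\rm f}}(\cdot),\Pi_{t_{\rm f}}(\cdot))$, with values in $\mathbb{S}^n_{++}\times\mathbb{S}^n$; it is the optimal covariance/co-state pair, with optimal gain $K=-R^{-1}B^{\top}\Pi_{t_{\rm f}}$. Hamiltonian: $\mathrm{H}(\Sigma,\Pi)=\tfrac12\varpi+\operatorname{tr}(\tfrac12Q\Sigma+\Pi A\Sigma)-\operatorname{tr}(\tfrac12\Pi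 BR^{-1}B^{\top}\Pi\Sigma-\tfrac12\Pi D)$. $\mathrm{H}_{t_{\rm f}}:=\mathrm{H}(\Sigma_{t_{\rm f}}(t),\Pi_{t_{\rm f}}(t))$, which does not depend on $t\in[0,t_{\rm f}]$. The value $t_{\rm f}=+\infty$ is called an asymptotic Hamiltonian-zero if $\lim_{t_{\rm f}\to+\infty}\mathrm{H}_{t_{\rm f}}=0$. Asymptotic point convergence assumption: the limiting trajectory $\Sigma_\star(t)=\lim_{t_{\rm f}\to+\infty}\Sigma_{t_{\rm f}}(t)$, $t\ge0$, exists (pointwise in $t$) and has a bounded positive-definite limit: $\lim_{t\to+\infty}\Sigma_\star(t)=\Sigma_\infty\succ0$. Asymptotic Connection: a limiting trajectory $\Sigma:[0,+\infty)\to\mathbb{S}^n$ obtained from the family $\{\Sigma_{t_{\rm f}}(\cdot)\}_{t_{\rm f}>0}$ as $t_{\rm f}\to+\infty$ (a limit, uniform on compact subintervals of $[0,+\infty)$, of $\Sigma_{t_{\rm f}^k}(\cdot)$ along some sequence $t_{\rm f}^k\to+\infty$) for which there exists $t_1\in(0,+\infty]$ such that $\lim_{t\to t_1}\Sigma(t)=\Sigma_{\rm s}$ for some $\Sigma_{\rm s}\in\mathcal{G}_\infty$. *)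

(* Defs.v *)
From HB Require Import structures.
From mathcomp Require Import all_boot all_order all_algebra.
From mathcomp Require Import all_classical all_reals all_analysis.
Import Order.TTheory GRing.Theory Num.Theory.
Import numFieldNormedType.Exports.

Set Implicit Arguments.
Unset Strict Implicit.
Unset Printing Implicit Defensive.

Local Open Scope classical_set_scope.
Local Open Scope ring_scope.

Definition symmetric_mx (R : realType) (n : nat) (S : 'M[R]_n) : Prop :=
  S^T = S.

Definition psd_mx (R : realType) (n : nat) (S : 'M[R]_n) : Prop :=
  symmetric_mx S /\ forall x : 'cV[R]_n, 0 <= (x^T *m S *m x) ord0 ord0.

Definition pd_mx (R : realType) (n : nat) (S : 'M[R]_n) : Prop :=
  symmetric_mx S /\
  forall x : 'cV[R]_n, x != 0 -> 0 < (x^T *m S *m x) ord0 ord0.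

(* [s] lists (a superset of) the finitely many discontinuities of [u] in
   ]0, T[; all one-sided limits within [0, T] exist. *)
Definition piecewise_continuous (R : realType) (m : nat) (T : R)
    (s : seq R) (u : R -> 'cV[R]_m) : Prop :=
  [/\ forall t : R, 0 < t < T -> t \notin s -> {for t, continuous u},
      forall t : R, 0 <= t < T -> cvg (u x @[x --> t^'+])
    & forall t : R, 0 < t <= T -> cvg (u x @[x --> t^'-])].

(* The pair (A, B) is controllable: any state can be transferred to any other
   one in any prescribed time T > 0 along x' = A x + B u, by a piecewise
   continuous input u. *)
Definition controllable (R : realType) (n m : nat)
    (A : 'M[R]_n) (B : 'M[R]_(n, m)) : Prop :=
  forall (T : R) (x0 x1 : 'cV[R]_n), 0 < T ->
  exists (s : seq R) (u : R -> 'cV[R]_m) (x : R -> 'cV[R]_n),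
    [/\ piecewise_continuous T s u,
        {within `[0, T], continuous x},
        forall t : R, 0 < t < T -> t \notin s ->
          is_derive t (1 : R) x (A *m x t + B *m u t),
        x 0 = x0
      & x T = x1].

(* [Sigma] and [Pi] are total functions of which only the restriction to
   [0, tf] matters.  The differential equations are required on ]0, tf[ and the
   functions are continuous on [0, tf]; as the right-hand sides are continuous
   functions of (Sigma, Pi), these are exactly the C^1 solutions on [0, tf]. *)
Definition steering_bvp (R : realType) (n m : nat)
    (A : 'M[R]_n) (B : 'M[R]_(n, m)) (D Q : 'M[R]_n) (Rw : 'M[R]_m)
    (Sigma0 Sigmaf : 'M[R]_n) (tf : R) (Sigma Pi : R -> 'M[R]_n) : Prop :=
  let G := B *m invmx Rw *m B^T in
  [/\ forall t : R, 0 <= t <= tf -> pd_mx (Sigma t) /\ symmetric_mx (Pi t),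
      {within `[0, tf], continuous Sigma} /\ {within `[0, tf], continuous Pi},
      forall t : R, 0 < t < tf ->
        is_derive t (1 : R) Pi
          (- Q - A^T *m Pi t - Pi t *m A + Pi t *m G *m Pi t),
      forall t : R, 0 < t < tf ->
        is_derive t (1 : R) Sigma
          ((A - G *m Pi t) *m Sigma t + Sigma t *m (A - G *m Pi t)^T + D)
    & Sigma 0 = Sigma0 /\ Sigma tf = Sigmaf].

Definition hamiltonian (R : realType) (n m : nat) (varpi : R)
    (A : 'M[R]_n) (B : 'M[R]_(n, m)) (D Q : 'M[R]_n) (Rw : 'M[R]_m)
    (Sigma Pi : 'M[R]_n) : R :=
  2^-1 * varpi + \tr (2^-1 *: (Q *m Sigma) + Pi *m A *m Sigma)
  - \tr (2^-1 *: (Pi *m B *m invmx Rw *m B^T *m Pi *m Sigma)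
         - 2^-1 *: (Pi *m D)).

(* H_tf: the Hamiltonian is constant along a solution on [0, tf], so it is read
   off at t = 0.  Here and below a family of trajectories is curried as
   [Sigma tf t]: first the final time, then the time. *)
Definition hamiltonian_at (R : realType) (n m : nat) (varpi : R)
    (A : 'M[R]_n) (B : 'M[R]_(n, m)) (D Q : 'M[R]_n) (Rw : 'M[R]_m)
    (Sigma Pi : R -> R -> 'M[R]_n) (tf : R) : R :=
  hamiltonian varpi A B D Q Rw (Sigma tf 0) (Pi tf 0).

Definition asymptotic_hamiltonian_zero (R : realType) (n m : nat) (varpi : R)
    (A : 'M[R]_n) (B : 'M[R]_(n, m)) (D Q : 'M[R]_n) (Rw : 'M[R]_m)
    (Sigma Pi : R -> R -> 'M[R]_n) : Prop :=
  hamiltonian_at varpi A B D Q Rw Sigma Pi tf @[tf --> +oo] --> (0 : R).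

Definition asymptotic_point_convergence (R : realType) (n : nat)
    (Sigma : R -> R -> 'M[R]_n) : Prop :=
  exists (Sigma_star : R -> 'M[R]_n) (Sigma_inf : 'M[R]_n),
    [/\ forall t : R, 0 <= t -> Sigma tf t @[tf --> +oo] --> Sigma_star t,
        Sigma_star t @[t --> +oo] --> Sigma_inf
      & pd_mx Sigma_inf].

Definition asymptotic_gateway (R : realType) (n : nat)
    (A D Q : 'M[R]_n) : set 'M[R]_n :=
  [set S | [/\ pd_mx S, A *m S + S *m A^T + D = 0 & \tr (Q *m S) = 0]].

Definition tends_to_at (R : realType) (n : nat) (Sigma : R -> 'M[R]_n)
    (t1 : \bar R) (S : 'M[R]_n) : Prop :=
  match t1 with
  | r%:E => Sigma t @[t --> r^'] --> S
  | +oo%E => Sigma t @[t --> +oo] --> S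
  | -oo%E => False
  end.

Definition asymptotic_connection (R : realType) (n : nat)
    (A D Q : 'M[R]_n) (Sigma : R -> R -> 'M[R]_n)
    (Sigma_lim : R -> 'M[R]_n) : Prop :=
  [/\ forall t : R, 0 <= t -> symmetric_mx (Sigma_lim t),
      exists tf : nat -> R,
        [/\ forall k : nat, 0 < tf k,
            tf k @[k --> \oo] --> +oo
          & forall a b : R, 0 <= a -> a <= b ->
            {uniform `[a, b],
              (fun k => Sigma (tf k)) @ \oo --> Sigma_lim}]
    & exists (t1 : \bar R) (Sigma_s : 'M[R]_n),
        [/\ (0 < t1)%E, asymptotic_gateway A D Q Sigma_s
          & tends_to_at Sigma_lim t1 Sigma_s]].

(* Main.v *)
(** A positive definite [S] in the gateway satisfies [tr (Q S) = 0], which forces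
    [Q = 0].  Write [G = B R^-1 B^T] and let [(Sigma, Pi)] solve the boundary
    value problem on [[0, T]].

    The matrix [M = Pi Sigma Pi] satisfies [M' = - A^T M - M A + Pi D Pi], so
    that [tr (M S)] is nondecreasing in time and, by controllability, [tr M (t)]
    is at most a constant times the energy [int_t^(t+1) tr (G M)].  The potential
    [V = tr (Pi (S - Sigma))] satisfies [V' = tr (G M) + tr (Pi G Pi S)], so it
    dominates this energy, and summing over unit windows gives
    [N tr (M (t) S) <= C (V (T - 1) - V 0)] as soon as [t + N <= T - 1].

    The right-hand side is bounded: on the last window [[T - 1, T]] the solution
    is compared with the one for horizon 1, which ends at the same [Sigmaf], and
    a Riccati solution defined on both sides of a point is bounded there in terms
    of minimal control energies only; [V 0] is controlled by [Pi 0], hence by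
    [tr (M (0) S)].  Letting [N] grow, [M] tends to 0 uniformly on compact time
    intervals.  Thus [Pi (0)] and the Hamiltonian tend to 0, the feedback term of
    the covariance equation vanishes in the limit, and the limit covariance at
    infinity is an equilibrium of the uncontrolled equation, that is, a point of
    the gateway. *)
Require Import Defs.
From mathcomp Require Import all_boot all_order all_algebra.
From mathcomp Require Import all_classical all_reals all_analysis.
From mathcomp Require Import ring lra.
Import Order.TTheory GRing.Theory Num.Theory.
Import numFieldNormedType.Exports.
Local Open Scope classical_set_scope.
Local Open Scope ring_scope.

Set Implicit Arguments.
Unset Strict Implicit.
Unset Printing Implicit Defensive.

(** * Frobenius norm and positive semidefinite matrices *)

(** The square of the Frobenius norm, kept unrooted so that the estimates stay polynomial. *)
Definition frob2 (R : realType) (m n : nat) (X : 'M[R]_(m, n)) : R :=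
  \tr (X *m X^T).

Lemma frob2E (R : realType) m n (X : 'M[R]_(m, n)) :
  frob2 X = \sum_i \sum_j X i j ^+ 2.
Proof.
by apply: eq_bigr => i _; rewrite mxE; apply: eq_bigr => j _; rewrite mxE expr2.
Qed.

Lemma frob2_ge0 (R : realType) m n (X : 'M[R]_(m, n)) : 0 <= frob2 X.
Proof. by rewrite frob2E; do 2![apply: sumr_ge0 => ? _]; exact: sqr_ge0. Qed.

Lemma frob2_entry (R : realType) m n (X : 'M[R]_(m, n)) i j :
  X i j ^+ 2 <= frob2 X.
Proof.
rewrite frob2E (bigD1 i)//= (bigD1 j)//= -addrA lerDl addr_ge0 ?sumr_ge0//.
  by move=> ? _; exact: sqr_ge0.
by move=> ? _; apply: sumr_ge0 => ? _; exact: sqr_ge0.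
Qed.

Lemma frob2_le0 (R : realType) m n (X : 'M[R]_(m, n)) : frob2 X <= 0 -> X = 0.
Proof.
move=> X0; apply/matrixP => i j; rewrite mxE; apply/eqP.
by rewrite -sqrf_eq0 eq_le sqr_ge0 (le_trans (frob2_entry _ _ _)).
Qed.

Lemma frob2T (R : realType) m n (X : 'M[R]_(m, n)) : frob2 X^T = frob2 X.
Proof. by rewrite /frob2 trmxK mxtrace_mulC. Qed.

Lemma frob2N (R : realType) m n (X : 'M[R]_(m, n)) : frob2 (- X) = frob2 X.
Proof. by rewrite /frob2 linearN mulNmx mulmxN opprK. Qed.

Lemma tr_mul_trmxC (R : realType) m n (X Y : 'M[R]_(m, n)) :
  \tr (X *m Y^T) = \tr (Y *m X^T).
Proof. by rewrite -mxtrace_tr trmx_mul trmxK. Qed.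

Lemma frob2D (R : realType) m n (X Y : 'M[R]_(m, n)) :
  frob2 (X + Y) = frob2 X + frob2 Y + 2 * \tr (X *m Y^T).
Proof.
rewrite /frob2 linearD mulmxDl !mulmxDr !linearD /= (tr_mul_trmxC Y X); ring.
Qed.

Lemma tr_mul_trmx_le (R : realType) m n (X Y : 'M[R]_(m, n)) :
  2 * \tr (X *m Y^T) <= frob2 X + frob2 Y.
Proof.
have := frob2_ge0 (X + - Y).
rewrite frob2D frob2N linearN mulmxN linearN /=; lra.
Qed.

Lemma frob2D_le (R : realType) m n (X Y : 'M[R]_(m, n)) :
  frob2 (X + Y) <= 2 * frob2 X + 2 * frob2 Y.
Proof. by rewrite frob2D; have := tr_mul_trmx_le X Y; lra. Qed.

Lemma cauchy_schwarz_sum (R : realType) n (a b : 'I_n -> R) :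
  (\sum_i a i * b i) ^+ 2 <= (\sum_i a i ^+ 2) * (\sum_i b i ^+ 2).
Proof.
set A := \sum_i a i ^+ 2; set B := \sum_i b i ^+ 2; set C := \sum_i a i * b i.
have B0 : 0 <= B by apply: sumr_ge0 => ? _; exact: sqr_ge0.
have [B_0|BN0] := eqVneq B 0.
  have b0 i : b i = 0.
    apply/eqP; rewrite -sqrf_eq0.
    by have/psumr_eq0P := B_0; move=> ->// j _; exact: sqr_ge0.
  by rewrite /C big1 ?expr0n/= ?B_0 ?mulr0// => i _; rewrite b0 mulr0.
(* The sum equals [B * (A * B - C ^+ 2)], and [B] is now positive. *)
have : 0 <= \sum_i (B * a i - C * b i) ^+ 2.
  by apply: sumr_ge0 => ? _; exact: sqr_ge0.
have -> : \sum_i (B * a i - C * b i) ^+ 2 = B * (A * B - C ^+ 2).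
  transitivity (\sum_i (B ^+ 2 * a i ^+ 2 + (- (2 * B * C) * (a i * b i)
      + C ^+ 2 * b i ^+ 2))); first by apply: eq_bigr => i _; ring.
  rewrite !big_split/= -!mulr_sumr -/A -/B -/C; ring.
by rewrite pmulr_rge0 ?subr_ge0// lt0r BN0.
Qed.

Lemma frob2M (R : realType) m n p (X : 'M[R]_(m, n)) (Y : 'M[R]_(n, p)) :
  frob2 (X *m Y) <= frob2 X * frob2 Y.
Proof.
rewrite -(frob2T Y) !frob2E mulr_suml ler_sum// => i _.
rewrite mulr_sumr ler_sum// => k _; rewrite mxE.
apply: le_trans (cauchy_schwarz_sum _ _) _.
by under [X in _ <= _ * X]eq_bigr => j _ do rewrite mxE.
Qed.

(** * Gram factorizations *)

Lemma tr_gram (R : realType) n p q (K : 'M[R]_(n, p)) (L : 'M[R]_(n, q)) :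
  \tr (K *m K^T *m (L *m L^T)) = frob2 (K^T *m L).
Proof.
by rewrite /frob2 trmx_mul trmxK -!mulmxA mxtrace_mulC !mulmxA.
Qed.

Lemma gram_psd (R : realType) n p (L : 'M[R]_(n, p)) : psd_mx (L *m L^T).
Proof.
split=> [|x]; first by rewrite /symmetric_mx trmx_mul trmxK.
rewrite (_ : _ *m _ *m x = (x^T *m L) *m (x^T *m L)^T).
  by rewrite -trace_mx11 frob2_ge0.
by rewrite trmx_mul trmxK !mulmxA.
Qed.

Lemma qform_col_mx (R : realType) n (a : 'M[R]_1) (b : 'M[R]_(n, 1))
    (C : 'M[R]_n) (t : R) (y : 'cV[R]_n) :
  ((col_mx t%:M y)^T *m block_mx a b^T b C *m col_mx t%:M y) 0 0 =
  t ^+ 2 * a 0 0 + 2 * t * (b^T *m y) 0 0 + (y^T *m C *m y) 0 0.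
Proof.
rewrite tr_col_mx mul_row_block mul_row_col tr_scalar_mx !mulmxDl.
rewrite !mul_scalar_mx !mul_mx_scalar -!scalemxAl.
have -> : y^T *m b = (b^T *m y)^T by rewrite trmx_mul trmxK.
rewrite !mxE; ring.
Qed.

(** Cholesky factorization by induction on the size: the Schur complement of the top left entry is
    again positive semidefinite. A zero pivot forces the rest of its column to vanish, and then all
    terms in the inverse of the pivot vanish too. *)
Lemma psd_gram (R : realType) n (S : 'M[R]_n) :
  psd_mx S -> exists L : 'M[R]_n, S = L *m L^T.
Proof.
elim: n S => [|n IH] S [Ssym Spos].
  by exists 0; apply/matrixP => -[].
pose S' : 'M[R]_(1 + n) := S.
pose a := ulsubmx S' 0 0; pose b := dlsubmx S'; pose C := drsubmx S'.
have Sb : S' = block_mx a%:M b^T b C.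
  rewrite -[LHS]submxK [ulsubmx _]mx11_scalar; congr block_mx.
  by rewrite /b -[dlsubmx _]/(dlsubmx _) trmx_dlsub -[S'^T]/(S^T) Ssym.
have q t (y : 'cV_n) : 0 <= t ^+ 2 * a + 2 * t * (b^T *m y) 0 0
    + (y^T *m C *m y) 0 0.
  by have := Spos (col_mx t%:M y); rewrite -/S' Sb qform_col_mx mxE eqxx.
have a0 : 0 <= a by have := q 1 0; rewrite !mulmx0 !mxE; lra.
have Csym : symmetric_mx C.
  by rewrite /symmetric_mx /C trmx_drsub -[S'^T]/(S^T) Ssym.
have ba : a != 0 \/ b = 0.
  have [a_0|] := eqVneq a 0; [right|by left].
  have bb0 (y : 'cV_n) : (b^T *m y) 0 0 = 0.
    apply/eqP/negPn/negP => by0.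
    (* With a zero pivot the form is affine in [t] with slope [2 * B]; the [t] chosen below gives it
       the value -1. *)
    set B := (b^T *m y) 0 0 in by0; set c := (y^T *m C *m y) 0 0.
    have := q (- (c + 1) / (2 * B)) y; rewrite -/B -/c a_0 mulr0.
    rewrite (_ : 2 * _ * B = - (c + 1)); first by lra.
    by field.
  apply: frob2_le0; rewrite -frob2T /frob2 trmxK trace_mx11.
  by rewrite bb0.
have C'psd : psd_mx (C - a^-1 *: (b *m b^T)).
  split=> [|y].
    by rewrite /symmetric_mx linearB linearZ/= trmx_mul trmxK Csym.
  have -> : y^T *m (C - a^-1 *: (b *m b^T)) *m y =
      y^T *m C *m y - a^-1 *: ((b^T *m y)^T *m (b^T *m y)).
    by rewrite mulmxBr mulmxBl -scalemxAr -scalemxAl trmx_mul trmxK !mulmxA.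
  have qy t := q t y; move: qy; set B := b^T *m y => qy.
  have -> : (y^T *m C *m y - a^-1 *: (B^T *m B)) 0 0 =
      (y^T *m C *m y) 0 0 - a^-1 * B 0 0 ^+ 2.
    rewrite [LHS]mxE; congr (_ + _).
    rewrite [LHS]mxE; congr (- _); rewrite [LHS]mxE; congr (_ * _).
    by rewrite [LHS]mxE big_ord1 [B^T _ _]mxE expr2.
  case: ba => [aN0|b0]; last first.
    have B0 : B 0 0 = 0 by rewrite /B b0 trmx0 mul0mx mxE.
    by have := qy 0; rewrite B0; lra.
  (* This [t] minimizes the form over the first coordinate, and the minimum is the Schur complement
     at [y]. *)
  have := qy (- a^-1 * B 0 0).
  rewrite (_ : (- a^-1 * B 0 0) ^+ 2 * a = a^-1 * (B 0 0) ^+ 2); first by lra.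
  by field.
have [L CL] := IH _ C'psd.
pose L' := block_mx (Num.sqrt a)%:M 0 ((Num.sqrt a)^-1 *: b) L.
suff : S' = L' *m L'^T by exists L'.
rewrite Sb tr_block_mx mulmx_block !trmx0 !tr_scalar_mx linearZ/=.
have saa : Num.sqrt a * Num.sqrt a = a by rewrite -expr2 sqr_sqrtr.
have sb : Num.sqrt a *: ((Num.sqrt a)^-1 *: b) = b.
  rewrite scalerA; case: ba => [aN0|->]; last by rewrite scaler0.
  by rewrite divff ?scale1r// sqrtr_eq0 -ltNge lt0r aN0.
rewrite !mul0mx !mulmx0 !addr0 -scalar_mxM saa mul_scalar_mx mul_mx_scalar.
have sbT : Num.sqrt a *: ((Num.sqrt a)^-1 *: b^T) = b^T.
  by rewrite -[in RHS]sb [RHS]linearZ/= [in RHS]linearZ.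
rewrite sb sbT -scalemxAl -scalemxAr scalerA -invfM saa.
by rewrite -CL addrC subrK.
Qed.

Lemma psd_tr_ge0 (R : realType) n (M N : 'M[R]_n) :
  psd_mx M -> psd_mx N -> 0 <= \tr (M *m N).
Proof.
by move=> /psd_gram[K ->] /psd_gram[L ->]; rewrite tr_gram frob2_ge0.
Qed.

Lemma pd_psd (R : realType) n (S : 'M[R]_n) : pd_mx S -> psd_mx S.
Proof.
move=> [Ssym Spos]; split=> // x; have [->|/Spos/ltW//] := eqVneq x 0.
by rewrite mulmx0 mxE.
Qed.

Lemma pd_unitmx (R : realType) n (S : 'M[R]_n) : pd_mx S -> S \in unitmx.
Proof.
move=> [_ Spos]; rewrite -row_free_unit; apply: inj_row_free => v vS.
apply/eqP/negPn/negP; rewrite -trmx_eq0 => /Spos.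
by rewrite trmxK vS mul0mx mxE ltxx.
Qed.

Lemma pd_gram (R : realType) n (S : 'M[R]_n) :
  pd_mx S -> exists2 L : 'M[R]_n, S = L *m L^T & L \in unitmx.
Proof.
move=> Spd; have [L SL] := psd_gram (pd_psd Spd); exists L => //.
by have := pd_unitmx Spd; rewrite SL unitmx_mul => /andP[].
Qed.

(** The trace is the squared norm of [K^T *m L] with [L] invertible. Applied to a point of the
    gateway, it removes the state weight from the whole problem. *)
Lemma psd_pd_tr_eq0 (R : realType) n (Q S : 'M[R]_n) :
  psd_mx Q -> pd_mx S -> \tr (Q *m S) = 0 -> Q = 0.
Proof.
move=> /psd_gram[K ->] /pd_gram[L -> Lu]; rewrite tr_gram => KL0.
have /frob2_le0 KL : frob2 (K^T *m L) <= 0 by rewrite KL0.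
have -> : K^T = 0 by rewrite -[K^T](mulmxK Lu) KL mul0mx.
by rewrite mulmx0.
Qed.

(** * Matrix-valued solutions of differential equations *)

Lemma cvg_mxP (R : realType) (T : Type) (F : set_system T) m n
    (f : T -> 'M[R]_(m, n)) (l : 'M[R]_(m, n)) : Filter F ->
  f @ F --> l <-> forall i j, f x i j @[x --> F] --> l i j.
Proof.
move=> FF; split=> [fl i j|fl].
  apply: (@cvg_comp _ _ _ f (fun M : 'M[R]_(m, n) => M i j) F _ _ fl).
  exact: coord_continuous.
apply/cvgrPdist_le => /= e e0; near=> x.
rewrite /Num.Def.normr/= mx_normrE (bigmax_le _ (ltW e0))//= => i _.
rewrite !mxE/=; move: i; near: x; apply: filter_forall => /= i.
by move/cvgrPdist_le : (fl i.1 i.2); exact.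
Unshelve. all: by end_near. Qed.

Lemma cvg_sum_ord (R : realType) (T : Type) (F : set_system T) n
    (f : 'I_n -> T -> R) (l : 'I_n -> R) : Filter F ->
  (forall i, f i x @[x --> F] --> l i) ->
  \sum_i f i x @[x --> F] --> \sum_i l i.
Proof.
move=> FF fl; have -> : (fun x => \sum_i f i x) = \sum_i f i.
  by apply/funext => x; rewrite fct_sumE.
elim/big_ind2 : _ => // [|g a h b ga hb]; first exact: cvg_cst.
exact: cvgD ga hb.
Qed.

Lemma cvg_mulmx (R : realType) (T : Type) (F : set_system T) m n p
    (f : T -> 'M[R]_(m, n)) (g : T -> 'M[R]_(n, p))
    (k : 'M[R]_(m, n)) (l : 'M[R]_(n, p)) : Filter F ->
  f @ F --> k -> g @ F --> l -> f x *m g x @[x --> F] --> k *m l.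
Proof.
move=> FF /cvg_mxP fk /cvg_mxP gl; apply/cvg_mxP => i j; rewrite mxE.
under eq_fun do rewrite mxE.
by apply: cvg_sum_ord => q; exact: cvgM (fk i q) (gl q j).
Qed.

Lemma cvg_mxtrace (R : realType) (T : Type) (F : set_system T) n
    (f : T -> 'M[R]_n) (l : 'M[R]_n) : Filter F ->
  f @ F --> l -> \tr (f x) @[x --> F] --> \tr l.
Proof. by move=> FF /cvg_mxP fl; apply: cvg_sum_ord => i. Qed.

Lemma cvg_trmx (R : realType) (T : Type) (F : set_system T) m n
    (f : T -> 'M[R]_(m, n)) (l : 'M[R]_(m, n)) : Filter F ->
  f @ F --> l -> (f x)^T @[x --> F] --> l^T.
Proof.
move=> FF /cvg_mxP fl; apply/cvg_mxP => i j; rewrite mxE.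
under eq_fun do rewrite mxE; exact: fl.
Qed.

Lemma is_derive_mxP (R : realType) m n (f : R -> 'M[R]_(m, n)) (t : R)
    (df : 'M[R]_(m, n)) :
  is_derive t (1 : R) f df <->
  forall i j, is_derive t (1 : R) (fun s => f s i j) (df i j).
Proof.
split=> [[fd fE] i j|fij].
  have fdij := (derivable_mxP _ _ _).1 fd i j.
  by split=> //; rewrite -fE derive_mx// mxE.
have fd : derivable f t 1.
  by apply/derivable_mxP => i j; have [] := fij i j.
split=> //; rewrite derive_mx//; apply/matrixP => i j; rewrite mxE.
by have [] := fij i j.
Qed.

(** The list [s] of exceptional times accommodates the jumps of piecewise continuous inputs; it is
    empty for the Riccati and covariance flows. *)
Definition solves (R : realType) (V : normedModType R) (a b : R) (s : seq R)
    (f df : R -> V) : Prop :=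
  {within `[a, b], continuous f} /\
  forall t : R, a < t < b -> t \notin s -> is_derive t (1 : R) f (df t).

Lemma solves_ext (R : realType) (V : normedModType R) (a b : R) (s : seq R)
    (f df dg : R -> V) :
  (forall t, a < t < b -> t \notin s -> df t = dg t) ->
  solves a b s f df -> solves a b s f dg.
Proof. by move=> e [fc fd]; split=> // t tab ts; rewrite -e//; exact: fd. Qed.

Lemma solves_weaken (R : realType) (V : normedModType R) (a b : R) (s : seq R)
    (f df : R -> V) : solves a b [::] f df -> solves a b s f df.
Proof. by move=> [fc fd]; split=> // t tab _; exact: fd. Qed.

Lemma solves_sub (R : realType) (V : normedModType R) (a b a' b' : R)
    (s : seq R) (f df : R -> V) :
  a <= a' -> b' <= b -> solves a b s f df -> solves a' b' s f df.
Proof.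
move=> aa bb [fc fd]; split=> [|t /andP[at_ tb]].
  apply: continuous_subspaceW fc => x /=; rewrite !in_itv/= => /andP[ax xb].
  by rewrite (le_trans aa)//= (le_trans xb).
by apply: fd; rewrite (le_lt_trans aa)//= (lt_le_trans tb).
Qed.

Lemma solves_cst (R : realType) (V : normedModType R) (a b : R) (s : seq R)
    (c : V) : solves a b s (fun=> c) (fun=> 0).
Proof.
split; first exact/continuous_subspaceT/cst_continuous.
by move=> t _ _; exact: is_derive_cst.
Qed.

Lemma solvesD (R : realType) (V : normedModType R) (a b : R) (s : seq R)
    (f g df dg : R -> V) : solves a b s f df -> solves a b s g dg ->
  solves a b s (fun t => f t + g t) (fun t => df t + dg t).
Proof.
move=> [fc fd] [gc gd]; split; first exact: within_continuousD.
by move=> t tab ts; apply: is_deriveD; [exact: fd|exact: gd].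
Qed.

Lemma solvesN (R : realType) (V : normedModType R) (a b : R) (s : seq R)
    (f df : R -> V) : solves a b s f df ->
  solves a b s (fun t => - f t) (fun t => - df t).
Proof.
move=> [fc fd]; split; first by move=> x; apply: cvgN; exact: fc.
by move=> t tab ts; apply: is_deriveN; exact: fd.
Qed.

Lemma solvesB (R : realType) (V : normedModType R) (a b : R) (s : seq R)
    (f g df dg : R -> V) : solves a b s f df -> solves a b s g dg ->
  solves a b s (fun t => f t - g t) (fun t => df t - dg t).
Proof. by move=> fs gs; apply: solvesD fs _; exact: solvesN. Qed.

Lemma solvesM (R : realType) (a b : R) (s : seq R) (f g df dg : R -> R) :
  solves a b s f df -> solves a b s g dg ->
  solves a b s (fun t => f t * g t) (fun t => df t * g t + f t * dg t).
Proof.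
move=> [fc fd] [gc gd]; split; first by move=> x; exact: cvgM (fc x) (gc x).
move=> t tab ts; have fd' := fd t tab ts; have gd' := gd t tab ts.
by apply: is_derive_eq (is_deriveM fd' gd') _; rewrite addrC/= mulrC.
Qed.

Lemma solves_mulmx (R : realType) m n p (a b : R) (s : seq R)
    (f df : R -> 'M[R]_(m, n)) (g dg : R -> 'M[R]_(n, p)) :
  solves a b s f df -> solves a b s g dg ->
  solves a b s (fun t => f t *m g t) (fun t => df t *m g t + f t *m dg t).
Proof.
move=> [fc fd] [gc gd]; split; first by move=> x; exact: cvg_mulmx (fc x) (gc x).
move=> t tab ts; apply/is_derive_mxP => i j.
have fij := (is_derive_mxP _ _ _).1 (fd t tab ts).
have gij := (is_derive_mxP _ _ _).1 (gd t tab ts).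
have -> : (fun u => (f u *m g u) i j) =
    \sum_(k < n) (fun u => f u i k) * (fun u => g u k j).
  by apply/funext => u; rewrite mxE fct_sumE.
apply: is_derive_eq (is_derive_sum (fun k => is_deriveM (fij i k) (gij k j))) _.
rewrite [RHS]mxE [X in X + _]mxE [X in _ + X]mxE -big_split/=.
by apply: eq_bigr => k _; rewrite addrC; congr (_ + _); rewrite [LHS]mulrC.
Qed.

Lemma solves_trmx (R : realType) m n (a b : R) (s : seq R)
    (f df : R -> 'M[R]_(m, n)) : solves a b s f df ->
  solves a b s (fun t => (f t)^T) (fun t => (df t)^T).
Proof.
move=> [fc fd]; split; first by move=> x; exact: cvg_trmx (fc x).
move=> t tab ts; apply/is_derive_mxP => i j; rewrite mxE.
under eq_fun do rewrite mxE.
exact: (is_derive_mxP _ _ _).1 (fd t tab ts) j i.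
Qed.

Lemma solves_mxtrace (R : realType) n (a b : R) (s : seq R)
    (f df : R -> 'M[R]_n) : solves a b s f df ->
  solves a b s (fun t => \tr (f t)) (fun t => \tr (df t)).
Proof.
move=> [fc fd]; split; first by move=> x; exact: cvg_mxtrace (fc x).
move=> t tab ts.
have -> : (fun u => \tr (f u)) = \sum_(k < n) (fun u => f u k k).
  by apply/funext => u; rewrite fct_sumE.
have fij := (is_derive_mxP _ _ _).1 (fd t tab ts).
exact: is_derive_sum (fun k => fij k k).
Qed.

Lemma solves_shift (R : realType) (V : normedModType R) (a b c : R)
    (f df : R -> V) : solves a b [::] f df ->
  solves (a + c) (b + c) [::] (fun t => f (t - c)) (fun t => df (t - c)).
Proof.
move=> [fc fd]; split.
  apply/subspace_continuousP => x /=; rewrite in_itv/= => /andP[ax xb].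
  have xab : [set` `[a, b]] (x - c) by rewrite /= in_itv/= lerBrDr ax lerBlDr.
  have fx := (subspace_continuousP _ _).1 fc (x - c) xab.
  apply: (cvg_comp _ f _ fx) => P /= [e /= e0 eP]; exists e => //= y xy.
  rewrite in_itv/= => /andP[ay yb]; apply: eP => /=.
    by rewrite opprB addrA subrK.
  by rewrite in_itv/= lerBrDr ay lerBlDr.
move=> t /andP[at_ tb] _.
have [|//|fdx fE] := fd (t - c); first by rewrite ltrBrDr at_ ltrBlDr.
have e : (fun h : R => h^-1 *: (((fun u => f (u - c)) \o shift t) (h *: 1)
      - f (t - c)))
    = (fun h : R => h^-1 *: ((f \o shift (t - c)) (h *: 1) - f (t - c))).
  by apply/funext => h /=; rewrite addrA.
by split; [rewrite /derivable e|rewrite /derive e].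
Qed.

(** * Monotonicity and Gronwall comparison *)

Lemma solves_le (R : realType) (a b : R) (s : seq R) (f df : R -> R) :
  solves a b s f df -> a <= b ->
  (forall t, a < t < b -> t \notin s -> 0 <= df t) -> f a <= f b.
Proof.
elim: s a b => [|c s IH] a b fs ab df0.
  have [fc fd] := fs.
  apply: (@ger0_derive1_ndecr _ f a b) => // x; rewrite in_itv/= => xab.
    by have [] := fd x xab.
  by rewrite derive1E; have [//|_ ->] := fd x xab; exact: df0.
(* The interval is cut at the exceptional time [c] if that lies inside; each piece avoids [c] and
   falls under the induction hypothesis. *)
have aux a' b' : a <= a' -> b' <= b -> a' <= b' ->
    (forall t, a' < t < b' -> t != c) -> f a' <= f b'.
  move=> aa bb ab' tc; have [fc fd] := solves_sub aa bb fs.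
  apply: IH => //.
    by split=> // t tab ts; apply: fd => //; rewrite inE negb_or tc.
  move=> t /[dup] /andP[at_ tb] tab ts; apply: df0.
    by rewrite (le_lt_trans aa)//= (lt_le_trans tb).
  by rewrite inE negb_or tc.
have [ca|ac] := leP c a.
  by apply: aux => // t /andP[at_ _]; rewrite gt_eqF// (le_lt_trans ca).
have [bc|cb] := leP b c.
  by apply: aux => // t /andP[_ tb]; rewrite lt_eqF// (lt_le_trans tb).
apply: (@le_trans _ _ (f c)).
  by apply: aux => //; rewrite ?ltW// => t /andP[_ tc]; rewrite lt_eqF.
by apply: aux => //; rewrite ?ltW// => t /andP[tc _]; rewrite gt_eqF.
Qed.

Lemma solves_expR (R : realType) (a b c l : R) (s : seq R) :
  solves a b s (fun t => expR (l * (t - c))) (fun t => l * expR (l * (t - c))).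
Proof.
have d (t : R) : is_derive t (1 : R) (fun t => expR (l * (t - c)))
    (l * expR (l * (t - c))).
  have h : is_derive t (1 : R) (fun t => l * (t - c)) l.
    apply: (@is_derive_eq _ _ _ (l \*: (fun t => t - c)) t 1).
    by rewrite subr0 scaler1.
  by apply: is_derive_eq (is_derive1_comp (is_derive_expR _) h) _; rewrite mulrC.
split=> [|t _ _]; last exact: d.
apply: continuous_subspaceT => x; apply: differentiable_continuous.
by apply/derivable1_diffP; have [] := d x.
Qed.

(** The function [G t - expR (- l * (t - a)) * f t] is nondecreasing. The forcing [g] enters through
    a primitive [G], so that no integral is formed. *)
Lemma gronwall (R : realType) (a b l : R) (s : seq R) (f df G g : R -> R) :
  a <= b -> 0 <= l -> solves a b s f df -> solves a b s G g ->
  (forall t, a < t < b -> t \notin s -> 0 <= g t /\ df t <= l * f t + g t) ->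
  f b <= expR (l * (b - a)) * (f a + (G b - G a)).
Proof.
move=> ab l0 fs Gs dfg.
have hs := solvesB Gs (solvesM (solves_expR a b a (- l) s) fs).
have := solves_le hs ab.
rewrite subrr mulr0 expR0 mul1r => h.
have {}h : G a - f a <= G b - expR (- l * (b - a)) * f b.
  apply: h => t tab ts; have [g0 fg] := dfg t tab ts.
  have e1 : expR (- l * (t - a)) <= 1.
    rewrite -expR0 ler_expR mulNr oppr_le0 mulr_ge0// subr_ge0 ltW//.
    by case/andP: tab.
  have e0 := expR_ge0 (- l * (t - a)).
  have := ler_wpM2l e0 fg; have := ler_wpM2r g0 e1; lra.
have {}h : expR (- l * (b - a)) * f b <= f a + (G b - G a) by lra.
by rewrite -ler_pdivrMl ?expR_gt0// -expRN -mulNr.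
Qed.

(** The version for data at the right end: [expR (l * (t - a)) * f t + expR (l * (b - a)) * G t] is
    nondecreasing. *)
Lemma gronwall_backward (R : realType) (a b l : R) (s : seq R)
    (f df G g : R -> R) :
  a <= b -> 0 <= l -> solves a b s f df -> solves a b s G g ->
  (forall t, a < t < b -> t \notin s -> 0 <= g t /\ - (l * f t + g t) <= df t) ->
  f a <= expR (l * (b - a)) * (f b + (G b - G a)).
Proof.
move=> ab l0 fs Gs dfg.
have hs := solvesD (solvesM (solves_expR a b a l s) fs)
  (solvesM (solves_cst a b s (expR (l * (b - a)))) Gs).
have := solves_le hs ab.
rewrite subrr mulr0 expR0 mul1r => h.
suff : f a + expR (l * (b - a)) * G a <=
  expR (l * (b - a)) * f b + expR (l * (b - a)) * G b by lra.
apply: h => t /[dup] tab /andP[at_ tb] ts; have [g0 fg] := dfg t tab ts.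
have e1 : expR (l * (t - a)) <= expR (l * (b - a)).
  by rewrite ler_expR ler_wpM2l// lerB// ltW.
have e0 := expR_ge0 (l * (t - a)).
have := ler_wpM2l e0 fg; have := ler_wpM2r g0 e1; lra.
Qed.

(** * Controllability with bounded inputs *)

Lemma solves_linear (R : realType) (a b c : R) (s : seq R) :
  solves a b s (fun t => c * t) (fun=> c).
Proof.
split=> [|t _ _].
  by apply: continuous_subspaceT => x; apply: cvgM; [exact: cvg_cst|exact: cvg_id].
apply: (@is_derive_eq _ _ _ (c \*: id) t 1); by rewrite scaler1.
Qed.

Lemma cvg_frob2 (R : realType) (T : Type) (F : set_system T) m n
    (f : T -> 'M[R]_(m, n)) (l : 'M[R]_(m, n)) : Filter F ->
  f @ F --> l -> frob2 (f x) @[x --> F] --> frob2 l.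
Proof. by move=> FF fl; apply: cvg_mxtrace; apply: cvg_mulmx => //; exact: cvg_trmx. Qed.

Lemma cvg_frob2_bounded (R : realType) (T : Type) (F : set_system T) m n
    (f : T -> 'M[R]_(m, n)) : ProperFilter F ->
  cvg (f @ F) -> exists c, \forall x \near F, frob2 (f x) <= c.
Proof.
move=> FF /cvg_frob2 fl; exists (frob2 (lim (f @ F)) + 1).
by apply: cvgr_le fl _ _; rewrite ltrDl.
Qed.

(** One-sided limits bound the input on either side of each time, and the value at that time is
    added; compactness of the segment yields a single bound. *)
Lemma piecewise_continuous_bounded (R : realType) m (T : R) (s : seq R)
    (u : R -> 'cV[R]_m) : piecewise_continuous T s u ->
  exists c, forall t, 0 <= t <= T -> frob2 (u t) <= c.
Proof.
move=> [_ ur ul].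
have loc x : 0 <= x <= T -> exists M, \forall y \near x,
    0 <= y <= T -> frob2 (u y) <= M.
  move=> /andP[x0 xT].
  have [M1 M1P] : exists M, \forall y \near x, x < y -> y <= T -> frob2 (u y) <= M.
    have [xltT|Tx] := ltP x T.
      have [|M MP] := @cvg_frob2_bounded R R x^'+ _ _ u _ (ur x _).
        by rewrite x0.
      by exists M; apply: filterS MP => y yM _.
    by exists 0; near=> y => xy yT; have := lt_le_trans xy yT; rewrite ltNge Tx.
  have [M2 M2P] : exists M, \forall y \near x, y < x -> 0 <= y -> frob2 (u y) <= M.
    have [x_gt0|x_le0] := ltP 0 x.
      have [|M MP] := @cvg_frob2_bounded R R x^'- _ _ u _ (ul x _).
        by rewrite x_gt0.
      by exists M; apply: filterS MP => y yM _.
    by exists 0; near=> y => yx y0; have := le_lt_trans y0 yx; rewrite ltNge x_le0.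
  exists (Num.max M1 (Num.max M2 (frob2 (u x)))).
  apply: filterS (filterI M1P M2P) => y [h1 h2] /andP[y0 yT]; rewrite !le_max.
  case: (ltgtP x y) => [xy|yx|<-].
  - by rewrite h1.
  - by rewrite h2 ?orbT.
  - by rewrite lexx !orbT.
(* The bound [M] is itself the parameter, filtered at [+oo]: local bounds become one that holds for
   all large [M]. *)
have /compact_near_coveringP/(_ R +oo%R
  (fun M x => 0 <= x <= T -> frob2 (u x) <= M)) :=
  @segment_compact R 0 T.
case=> [x /=|M [_ MP]].
  rewrite in_itv/= => /loc[M MP].
  exists ([set y | 0 <= y <= T -> frob2 (u y) <= M], [set i | M <= i]) => /=.
    by split=> //=; apply: nbhs_pinfty_ge; exact: num_real.
  by move=> [y i] /= [yM Mi] /yM; move/le_trans; exact.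
exists (M + 1) => t tT; apply: (MP (M + 1)) => //=; first by rewrite ltrDl.
Unshelve. all: by end_near. Qed.

(** The horizon is 1 because every window is translated to [[0, 1]]. The pointwise bound [c] also
    bounds the control energy over that window. *)
Definition steers (R : realType) n m (A : 'M[R]_n) (b : 'M[R]_(n, m))
    (x0 x1 : 'cV[R]_n) (c : R) : Prop :=
  exists (s : seq R) (w : R -> 'cV[R]_m) (x : R -> 'cV[R]_n),
    [/\ solves 0 1 s x (fun t => A *m x t + b *m w t),
        forall t, 0 <= t <= 1 -> frob2 (w t) <= c, x 0 = x0 & x 1 = x1].

(* Normalizing the input by a square root of the weight [Rw] turns
   [B Rw^-1 B^T] into [b b^T]. *)
Lemma controllable_steers (R : realType) n m (A : 'M[R]_n) (B : 'M[R]_(n, m))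
    (Rw : 'M[R]_m) : controllable A B -> pd_mx Rw ->
  exists2 b : 'M[R]_(n, m), B *m invmx Rw *m B^T = b *m b^T &
    forall x0 x1, exists c, steers A b x0 x1 c.
Proof.
move=> AB /pd_gram[K -> Ku].
have iK : invmx (K *m K^T) = (invmx K)^T *m invmx K.
  have KTu : K^T \in unitmx by rewrite unitmx_tr.
  rewrite -[LHS]mulmx1 -[RHS]mul1mx.
  have KKu : K *m K^T \in unitmx by rewrite unitmx_mul Ku.
  apply: (can_inj (mulKmx KKu)); rewrite mulKVmx// mul1mx trmx_inv.
  by rewrite -mulmxA [K^T *m _]mulKVmx// mulmxV.
exists (B *m (invmx K)^T) => [|x0 x1].
  by rewrite iK trmx_mul trmxK !mulmxA.
have [s [u [x [up xc xd x0E x1E]]]] := AB 1 x0 x1 ltr01.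
have [c cP] := piecewise_continuous_bounded up.
exists (frob2 K^T * c), s, (fun t => K^T *m u t), x; split=> //.
  split=> // t tab ts; rewrite -mulmxA [_ *m (K^T *m _)]mulmxA -trmx_mul mulmxV//.
  by rewrite trmx1 mul1mx; exact: xd.
move=> t tab; apply: le_trans (frob2M _ _) _.
by rewrite ler_wpM2l ?frob2_ge0// cP.
Qed.

(** * Trace identities along the Riccati flow *)

Lemma mxtraceN (R : realType) n (X : 'M[R]_n) : \tr (- X) = - \tr X.
Proof. exact: linearN. Qed.

Ltac mx_expand := rewrite ?(mulmxDl, mulmxDr, mulNmx, mulmxN,
  mxtraceD, mxtraceN, opprD, opprK, mulmxA).

Ltac mx_abelian :=
  repeat match goal with |- context [?X *m ?Y] =>
    let W := fresh "W" in set W := X *m Y; clearbody W end;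
  apply/matrixP => ? ?; rewrite !mxE; ring.

(** The left side is the derivative of [\tr (Pi *m Y)] when [Pi] follows the Riccati equation and
    [Y] the covariance equation with feedback [K]; the terms in [A] cancel by cyclicity. *)
Lemma tr_riccati_covariance (R : realType) n (A G D Pi K Y : 'M[R]_n) :
  symmetric_mx G -> symmetric_mx Pi -> symmetric_mx K -> symmetric_mx Y ->
  \tr ((- A^T *m Pi - Pi *m A + Pi *m G *m Pi) *m Y
    + Pi *m ((A - G *m K) *m Y + Y *m (A - G *m K)^T + D)) =
  \tr (Pi *m G *m Pi *m Y) - 2 * \tr (Pi *m G *m K *m Y) + \tr (Pi *m D).
Proof.
rewrite /symmetric_mx => Gs Ps Ks Ys.
rewrite [(A - _)^T]linearB/= trmx_mul Ks Gs; mx_expand.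
have -> : \tr (A^T *m Pi *m Y) = \tr (Pi *m Y *m A^T).
  by rewrite -mulmxA mxtrace_mulC.
have -> : \tr (Pi *m Y *m K *m G) = \tr (Pi *m G *m K *m Y).
  by rewrite -mxtrace_tr !trmx_mul Gs Ps Ks Ys !mulmxA mxtrace_mulC !mulmxA.
ring.
Qed.

Lemma tr_completion (R : realType) n (G Pi K Y : 'M[R]_n) :
  symmetric_mx G -> symmetric_mx Pi -> symmetric_mx K -> symmetric_mx Y ->
  \tr ((Pi - K) *m G *m (Pi - K) *m Y) = \tr (Pi *m G *m Pi *m Y)
    - 2 * \tr (Pi *m G *m K *m Y) + \tr (K *m G *m K *m Y).
Proof.
rewrite /symmetric_mx => Gs Ps Ks Ys; mx_expand.
have -> : \tr (K *m G *m Pi *m Y) = \tr (Pi *m G *m K *m Y).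
  by rewrite -mxtrace_tr !trmx_mul Gs Ps Ks Ys mxtrace_mulC !mulmxA.
ring.
Qed.

Section steering_flow.
Context (R : realType) (n m : nat).
Variables (A : 'M[R]_n) (b : 'M[R]_(n, m)) (D : 'M[R]_n).
Let G := b *m b^T.

Let Gs : symmetric_mx G.
Proof. by rewrite /symmetric_mx trmx_mul trmxK. Qed.

(** The co-state equation for [Q = 0], the only case left once the gateway is nonempty. *)
Definition riccati (t0 t1 : R) (Pi : R -> 'M[R]_n) : Prop :=
  solves t0 t1 [::] Pi
    (fun t => - A^T *m Pi t - Pi t *m A + Pi t *m G *m Pi t) /\
  forall t, t0 <= t <= t1 -> symmetric_mx (Pi t).

(** The feedback [K] is free, which covers competitors and, with [K = 0], the uncontrolled
    equilibrium. *)
Definition cov_flow (t0 t1 : R) (K Sigma : R -> 'M[R]_n) : Prop :=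
  solves t0 t1 [::] Sigma (fun t =>
    (A - G *m K t) *m Sigma t + Sigma t *m (A - G *m K t)^T + D) /\
  forall t, t0 <= t <= t1 -> psd_mx (Sigma t).

Lemma riccati_sub t0 t1 t0' t1' Pi : t0 <= t0' -> t1' <= t1 ->
  riccati t0 t1 Pi -> riccati t0' t1' Pi.
Proof.
move=> t00 t11 [Ps Psym]; split; first exact: solves_sub Ps.
by move=> t /andP[t0t tt1]; apply: Psym; rewrite (le_trans t00)//= (le_trans tt1).
Qed.

Lemma cov_flow_sub t0 t1 t0' t1' K Sigma : t0 <= t0' -> t1' <= t1 ->
  cov_flow t0 t1 K Sigma -> cov_flow t0' t1' K Sigma.
Proof.
move=> t00 t11 [Ss Spsd]; split; first exact: solves_sub Ss.
by move=> t /andP[t0t tt1]; apply: Spsd; rewrite (le_trans t00)//= (le_trans tt1).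
Qed.

Lemma riccati_shift c t0 t1 Pi : riccati t0 t1 Pi ->
  riccati (t0 + c) (t1 + c) (fun t => Pi (t - c)).
Proof.
move=> [Ps Psym]; split; first exact: solves_shift Ps.
by move=> t tt; apply: Psym; rewrite lerBrDr lerBlDr.
Qed.

Lemma cov_flow_shift c t0 t1 K Sigma : cov_flow t0 t1 K Sigma ->
  cov_flow (t0 + c) (t1 + c) (fun t => K (t - c)) (fun t => Sigma (t - c)).
Proof.
move=> [Ss Spsd]; split; first exact: solves_shift Ss.
by move=> t tt; apply: Spsd; rewrite lerBrDr lerBlDr.
Qed.

Let itvW (t0 t1 t : R) : t0 < t < t1 -> t0 <= t <= t1.
Proof. by move=> /andP[/ltW -> /ltW ->]. Qed.

(* Completing the square against a competitor [Y] with feedback [K]. *)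
Lemma duality t0 t1 Pi Sigma K Y :
  riccati t0 t1 Pi -> cov_flow t0 t1 Pi Sigma -> cov_flow t0 t1 K Y ->
  (forall t, t0 <= t <= t1 -> symmetric_mx (K t)) ->
  solves t0 t1 [::] (fun t => \tr (Pi t *m (Y t - Sigma t)))
   (fun t => \tr (Pi t *m G *m Pi t *m Sigma t)
     + \tr ((Pi t - K t) *m G *m (Pi t - K t) *m Y t)
     - \tr (K t *m G *m K t *m Y t)).
Proof.
move=> [Ps Psym] [Ss Spsd] [Ys Ypsd] Ksym.
apply: solves_ext (solves_mxtrace (solves_mulmx Ps (solvesB Ys Ss))).
move=> t /itvW tt _ /=.
have Pst := Psym t tt; have Kst := Ksym t tt.
have [Sst _] := Spsd t tt; have [Yst _] := Ypsd t tt.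
rewrite tr_completion//.
have e1 := tr_riccati_covariance A D Gs Pst Kst Yst.
have e2 := tr_riccati_covariance A D Gs Pst Pst Sst.
rewrite mulmxBr mulmxBr addrACA -opprD linearB/= {}e1 {}e2; ring.
Qed.

(** The terms in [G] coming from the two Riccati factors cancel those of the covariance, which
    leaves a Lyapunov equation with source [Pi D Pi]. *)
Lemma costate_solves t0 t1 Pi Sigma :
  riccati t0 t1 Pi -> cov_flow t0 t1 Pi Sigma ->
  solves t0 t1 [::] (fun t => Pi t *m Sigma t *m Pi t)
    (fun t => - A^T *m (Pi t *m Sigma t *m Pi t)
      - Pi t *m Sigma t *m Pi t *m A + Pi t *m D *m Pi t).
Proof.
move=> [Ps Psym] [Ss Spsd].
apply: solves_ext (solves_mulmx (solves_mulmx Ps Ss) Ps).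
move=> t /itvW tt _ /=; have := Psym t tt; rewrite /symmetric_mx => Pst.
rewrite [(A - _)^T]linearB/= trmx_mul Pst [G^T]Gs; mx_expand; mx_abelian.
Qed.

Lemma solves_outer (t0 t1 : R) s (w : R -> 'cV[R]_m) (x : R -> 'cV[R]_n) :
  solves t0 t1 s x (fun t => A *m x t + b *m w t) ->
  solves t0 t1 s (fun t => x t *m (x t)^T)
    (fun t => (A *m x t + b *m w t) *m (x t)^T
       + x t *m (A *m x t + b *m w t)^T).
Proof. by move=> xs; exact: solves_mulmx xs (solves_trmx xs). Qed.

(** Derivative of [x^T N x] along a controlled path, used for [N = Pi] and for [N = Pi Sigma Pi]:
    the drift cancels, the source [C] and the input remain. *)
Lemma tr_outer_derive (N C : 'M[R]_n) (x : 'cV[R]_n) (w : 'cV[R]_m) :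
  symmetric_mx N ->
  \tr ((- A^T *m N - N *m A + C) *m (x *m x^T)
    + N *m ((A *m x + b *m w) *m x^T + x *m (A *m x + b *m w)^T)) =
  \tr (C *m (x *m x^T)) + 2 * \tr (N *m (b *m w) *m x^T).
Proof.
rewrite /symmetric_mx => Ns; rewrite [(_ + _)^T]linearD/= !trmx_mul; mx_expand.
have -> : \tr (A^T *m N *m x *m x^T) = \tr (N *m x *m x^T *m A^T).
  by rewrite -!mulmxA mxtrace_mulC -!mulmxA.
have -> : \tr (N *m x *m w^T *m b^T) = \tr (N *m b *m w *m x^T).
  by rewrite -mxtrace_tr !trmx_mul !trmxK Ns !mulmxA mxtrace_mulC !mulmxA.
ring.
Qed.

(* [(x^T Pi x)' = |b^T Pi x + w|^2 - |w|^2]. *)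
Lemma riccati_steers x0 x1 c Pi : steers A b x0 x1 c -> riccati 0 1 Pi ->
  \tr (Pi 0 *m (x0 *m x0^T)) <= \tr (Pi 1 *m (x1 *m x1^T)) + c.
Proof.
move=> [s [w [x [xs wc <- <-]]]] [Ps Psym].
have := solves_le (solvesD (solves_mxtrace (solves_mulmx (solves_weaken s Ps)
  (solves_outer xs))) (solves_linear 0 1 c s)) ler01.
rewrite mulr0 addr0 mulr1 => h; apply: h => t /itvW tt _.
rewrite tr_outer_derive; last exact: Psym.
have Pst : (Pi t)^T = Pi t := Psym t tt.
have -> : \tr (Pi t *m G *m Pi t *m (x t *m (x t)^T)) = frob2 (b^T *m Pi t *m x t).
  rewrite /frob2 !trmx_mul trmxK Pst [RHS]mxtrace_mulC !mulmxA.
  by rewrite [LHS]mxtrace_mulC !mulmxA.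
have -> : \tr (Pi t *m (b *m w t) *m (x t)^T) =
    \tr (w t *m (b^T *m Pi t *m x t)^T).
  by rewrite !trmx_mul trmxK Pst !mulmxA [RHS]mxtrace_mulC !mulmxA
    [RHS]mxtrace_mulC !mulmxA.
have := frob2_ge0 (b^T *m Pi t *m x t + w t).
rewrite frob2D tr_mul_trmxC; have := wc t tt; lra.
Qed.

(** With [Sigma = L L^T] and [N = Pi L], the derivative of [|N^T x|^2] is at least
    [- |N^T x|^2 - |N^T b|^2 |w|^2], where [|N^T b|^2] is the energy density, bounded by [dV]. The
    path ends at 0, so backward Gronwall leaves only the increment of [V]. *)
Lemma observability_steers x0 c Pi Sigma V dV :
  psd_mx D -> steers A b x0 0 c -> 
  riccati 0 1 Pi -> cov_flow 0 1 Pi Sigma -> solves 0 1 [::] V dV ->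
  (forall t, 0 < t < 1 -> \tr (Pi t *m G *m Pi t *m Sigma t) <= dV t) ->
  \tr (Pi 0 *m Sigma 0 *m Pi 0 *m (x0 *m x0^T)) <= expR 1 * (c * (V 1 - V 0)).
Proof.
move=> Dpsd [s [w [x [xs wc <- x1]]]] Pr Sc Vs dVE.
have Ms := solves_mxtrace (solves_mulmx (solves_weaken s (costate_solves Pr Sc))
  (solves_outer xs)).
have cVs := solvesM (solves_cst 0 1 s c) (solves_weaken s Vs).
have c0 : 0 <= c by apply: le_trans (frob2_ge0 _) (wc 0 _); rewrite lexx ler01.
have := gronwall_backward ler01 ler01 Ms cVs.
rewrite x1 mul0mx mulmx0 mxtrace0 add0r -mulrBr mul1r subr0 => h; apply: h.
move=> t tt _; have tt' := itvW tt; have [Ps Psym] := Pr; have [_ Spsd] := Sc.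
have Pst : (Pi t)^T = Pi t := Psym t tt'.
have [L SL] := psd_gram (Spsd t tt').
have Msym : symmetric_mx (Pi t *m Sigma t *m Pi t).
  by rewrite /symmetric_mx !trmx_mul Pst SL trmx_mul trmxK !mulmxA.
rewrite mul0r add0r mul1r tr_outer_derive//.
have E : \tr (Pi t *m G *m Pi t *m Sigma t) = frob2 ((Pi t *m L)^T *m b).
  rewrite -tr_gram trmx_mul Pst SL.
  transitivity (\tr ((Pi t *m G) *m (Pi t *m (L *m L^T)))).
    by rewrite !mulmxA.
  by rewrite mxtrace_mulC !mulmxA.
have ME : Pi t *m Sigma t *m Pi t = Pi t *m L *m (Pi t *m L)^T.
  by rewrite SL trmx_mul Pst !mulmxA.
have E0 := frob2_ge0 ((Pi t *m L)^T *m b).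
have dVt := dVE t tt; rewrite E in dVt.
split; first by rewrite mulr_ge0// (le_trans E0).
have -> : \tr (Pi t *m Sigma t *m Pi t *m (x t *m (x t)^T)) =
    frob2 ((Pi t *m L)^T *m x t) by rewrite ME tr_gram.
have -> : \tr (Pi t *m Sigma t *m Pi t *m (b *m w t) *m (x t)^T) =
    \tr ((Pi t *m L)^T *m x t *m ((Pi t *m L)^T *m b *m w t)^T).
  rewrite ME; move: (Pi t *m L) => N.
  by rewrite [RHS]tr_mul_trmxC [in RHS]trmx_mul trmxK [in RHS]mulmxA
    [RHS]mxtrace_mulC !mulmxA.
have T0 : 0 <= \tr (Pi t *m D *m Pi t *m (x t *m (x t)^T)).
  apply: psd_tr_ge0; last exact: gram_psd.
  have [N ->] := psd_gram Dpsd.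
  by rewrite -{2}Pst !mulmxA -mulmxA -trmx_mul; exact: gram_psd.
have := frob2_ge0 ((Pi t *m L)^T *m x t + (Pi t *m L)^T *m b *m w t).
rewrite frob2D.
have := frob2M ((Pi t *m L)^T *m b) (w t).
have := ler_wpM2l E0 (wc t tt'); have := ler_wpM2r c0 dVt; lra.
Qed.
End steering_flow.

(** * Bounds uniform in the horizon *)

Lemma tr_mul_gram_cols (R : realType) n p (P : 'M[R]_n) (L : 'M[R]_(n, p)) :
  \tr (P *m (L *m L^T)) = \sum_i \tr (P *m (col i L *m (col i L)^T)).
Proof.
have -> : L *m L^T = \sum_i col i L *m (col i L)^T.
  apply/matrixP => i j; rewrite summxE mxE; apply: eq_bigr => k _.
  by rewrite !mxE big_ord1 !mxE.
by rewrite mulmx_sumr linear_sum.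
Qed.

Lemma psd_tr_le (R : realType) n (M N : 'M[R]_n) :
  psd_mx M -> psd_mx N -> \tr (M *m N) <= \tr M * \tr N.
Proof.
move=> /psd_gram[K ->] /psd_gram[L ->]; rewrite tr_gram.
by apply: le_trans (frob2M _ _) _; rewrite frob2T.
Qed.

Lemma pd_frob2_le (R : realType) n (S : 'M[R]_n) : pd_mx S ->
  exists2 k, 0 <= k & forall p (N : 'M[R]_(n, p)),
    frob2 N <= k * \tr (N^T *m S *m N).
Proof.
move=> /pd_gram[L -> Lu]; exists (frob2 (invmx L^T)) => [|p N].
  exact: frob2_ge0.
have -> : \tr (N^T *m (L *m L^T) *m N) = frob2 (L^T *m N).
  by rewrite -frob2T /frob2 trmxK trmx_mul trmxK !mulmxA.
rewrite -{1}[N](mulKmx (_ : L^T \in unitmx)) ?unitmx_tr//; exact: frob2M.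
Qed.

Section uniform_bounds.
Context (R : realType) (n m : nat).
Variables (A : 'M[R]_n) (b : 'M[R]_(n, m)) (D : 'M[R]_n).
Hypothesis Dpsd : psd_mx D.
Hypothesis Ab : forall x0 x1, exists c, steers A b x0 x1 c.
Let G := b *m b^T.

Let Gpsd : psd_mx G. Proof. exact: gram_psd. Qed.

Lemma psd_congr (P N : 'M[R]_n) :
  symmetric_mx P -> psd_mx N -> psd_mx (P *m N *m P).
Proof.
move=> Ps /psd_gram[L ->].
by rewrite -{2}Ps !mulmxA -mulmxA -trmx_mul; exact: gram_psd.
Qed.

(** Each column of [L] is steered to 0 on the window after [t0]: the terminal term vanishes and the
    input cost does not depend on [Pi]. The lower bound that follows steers from 0 to the columns
    instead. *)
Lemma riccati_upper_bound p (L : 'M[R]_(n, p)) :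
  exists C, forall t0 Pi, riccati A b t0 (t0 + 1) Pi ->
    \tr (Pi t0 *m (L *m L^T)) <= C.
Proof.
have [c cP] := choice (fun i => Ab (col i L) 0).
exists (\sum_i c i) => t0 Pi /(@riccati_shift _ _ _ _ _ (- t0)).
rewrite subrr addrAC subrr add0r => Pr.
rewrite tr_mul_gram_cols ler_sum// => i _.
have := riccati_steers (cP i) Pr.
by rewrite mul0mx mulmx0 mxtrace0 add0r sub0r opprK.
Qed.

Lemma riccati_lower_bound p (L : 'M[R]_(n, p)) :
  exists C, forall t0 Pi, riccati A b t0 (t0 + 1) Pi ->
    - C <= \tr (Pi (t0 + 1) *m (L *m L^T)).
Proof.
have [c cP] := choice (fun i => Ab 0 (col i L)).
exists (\sum_i c i) => t0 Pi /(@riccati_shift _ _ _ _ _ (- t0)).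
rewrite subrr addrAC subrr add0r => Pr.
rewrite tr_mul_gram_cols -sumrN ler_sum// => i _.
have := riccati_steers (cP i) Pr.
rewrite mul0mx mulmx0 mxtrace0 opprK (addrC 1 t0); lra.
Qed.

(** Steering every basis vector to 0 and summing gives the full trace. *)
Lemma observability : exists2 C, 0 <= C &
  forall t0 Pi Sigma V dV, riccati A b t0 (t0 + 1) Pi ->
    cov_flow A b D t0 (t0 + 1) Pi Sigma -> solves t0 (t0 + 1) [::] V dV ->
    (forall t, t0 < t < t0 + 1 -> \tr (Pi t *m G *m Pi t *m Sigma t) <= dV t) ->
  \tr (Pi t0 *m Sigma t0 *m Pi t0) <= C * (V (t0 + 1) - V t0).
Proof.
have [c cP] := choice (fun i => Ab (col i (1%:M : 'M[R]_n)) 0).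
exists (expR 1 * \sum_i c i).
  rewrite mulr_ge0 ?expR_ge0// sumr_ge0// => i _.
  have [s [w [x [_ wc _ _]]]] := cP i.
  by apply: le_trans (frob2_ge0 _) (wc 0 _); rewrite lexx ler01.
move=> t0 Pi Sigma V dV /(@riccati_shift _ _ _ _ _ (- t0)) Pr.
move=> /(@cov_flow_shift _ _ _ _ _ _ (- t0)) Sc.
move=> /(@solves_shift _ _ _ _ (- t0)) Vs dVE; move: Pr Sc Vs.
rewrite subrr addrAC subrr add0r => Pr Sc Vs.
have -> : \tr (Pi t0 *m Sigma t0 *m Pi t0) =
    \tr (Pi t0 *m Sigma t0 *m Pi t0 *m (1%:M *m 1%:M^T)).
  by rewrite trmx1 !mulmx1.
rewrite tr_mul_gram_cols.
rewrite -mulrA mulr_suml mulr_sumr ler_sum// => i _.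
have := observability_steers Dpsd (cP i) Pr Sc Vs.
rewrite sub0r opprK (addrC 1); apply => t /andP[t_gt0 t_lt1].
by apply: dVE; rewrite ltrDr t_gt0 addrC ltrD2l.
Qed.

Lemma energy_bounded Pi Sigma :
  riccati A b 0 1 Pi -> cov_flow A b D 0 1 Pi Sigma ->
  exists c, forall t, 0 <= t <= 1 -> \tr (Pi t *m G *m Pi t *m Sigma t) <= c.
Proof.
move=> [Ps _] [Ss _].
have [Ec _] := solves_mxtrace (solves_mulmx (solves_mulmx (solves_mulmx Ps
  (solves_cst 0 1 [::] G)) Ps) Ss).
have [t0 _ t0P] := EVT_max (@ler01 R) Ec.
by eexists => t tt; apply: t0P; rewrite in_itv.
Qed.

(** By [duality] with the translated pair [(K, Y)], the derivative of [\tr (Pi (Y - Sigma))] is at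
    least [- c], and this trace vanishes at the right end, where the covariances agree. *)
Lemma competitor_bound c t0 Pi Sigma K Y :
  riccati A b t0 (t0 + 1) Pi -> cov_flow A b D t0 (t0 + 1) Pi Sigma ->
  riccati A b 0 1 K -> cov_flow A b D 0 1 K Y -> Y 1 = Sigma (t0 + 1) ->
  (forall t, 0 <= t <= 1 -> \tr (K t *m G *m K t *m Y t) <= c) ->
  \tr (Pi t0 *m (Y 0 - Sigma t0)) <= c.
Proof.
move=> Pr Sc /(riccati_shift t0) Kr /(cov_flow_shift t0) Yc Y1 cP.
move: Kr Yc; rewrite add0r (addrC 1) => Kr Yc.
have := solves_le (solvesD (duality Pr Sc Yc Kr.2)
  (solves_linear t0 (t0 + 1) c [::])).
rewrite lerDl ler01 subrr -(addrC 1) addrK Y1 (addrC 1) subrr mulmx0 mxtrace0.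
rewrite add0r => h.
suff : \tr (Pi t0 *m (Y 0 - Sigma t0)) + c * t0 <= c * (t0 + 1) by lra.
apply: h => // t /andP[tt0 tt1] _.
have tt : t0 <= t <= t0 + 1 by rewrite !ltW.
have := cP (t - t0); rewrite subr_ge0 lerBlDr (addrC 1) tt => /(_ isT) h.
have Ys := Yc.2 t tt; have Ss := Sc.2 t tt.
have PKs : symmetric_mx (Pi t - K (t - t0)).
  by rewrite /symmetric_mx linearB/= (Pr.2 t tt) (Kr.2 t tt).
have := psd_tr_ge0 (psd_congr (Pr.2 t tt) Gpsd) Ss.
have := psd_tr_ge0 (psd_congr PKs Gpsd) Ys; rewrite -/G; lra.
Qed.

(** * Monotone quantities attached to an equilibrium *)

Section equilibrium.
Variable (S : 'M[R]_n).
Hypothesis Spd : pd_mx S.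
Hypothesis Seq : A *m S + S *m A^T + D = 0.

(** With [M = Pi Sigma Pi], the equilibrium equation turns the drift terms into [\tr (M D)]; the
    derivative is this plus [\tr (Pi D Pi S)], both nonnegative. *)
Lemma tr_costate_ndecr t0 t1 Pi Sigma : t0 <= t1 ->
  riccati A b t0 t1 Pi -> cov_flow A b D t0 t1 Pi Sigma ->
  \tr (Pi t0 *m Sigma t0 *m Pi t0 *m S) <= \tr (Pi t1 *m Sigma t1 *m Pi t1 *m S).
Proof.
move=> t01 Pr Sc.
apply: (solves_le (solves_mxtrace (solves_mulmx (costate_solves Pr Sc)
  (solves_cst t0 t1 [::] S))) t01) => t /andP[tt0 tt1] _.
have tt : t0 <= t <= t1 by rewrite !ltW.
rewrite mulmx0 addr0; have Ps := Pr.2 t tt.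
have := psd_tr_ge0 (psd_congr Ps Dpsd) (pd_psd Spd).
have := psd_tr_ge0 (psd_congr Ps (Sc.2 t tt)) Dpsd.
have : \tr (Pi t *m Sigma t *m Pi t *m (A *m S + S *m A^T + D)) = 0.
  by rewrite Seq mulmx0 mxtrace0.
move: (Pi t *m Sigma t *m Pi t) (Pi t *m D *m Pi t) => N ND; mx_expand.
have -> : \tr (A^T *m N *m S) = \tr (N *m S *m A^T).
  by rewrite -mulmxA mxtrace_mulC.
lra.
Qed.

(** This is [duality] against the constant competitor [S] with zero feedback. *)
Lemma potential_solves t0 t1 Pi Sigma :
  riccati A b t0 t1 Pi -> cov_flow A b D t0 t1 Pi Sigma ->
  solves t0 t1 [::] (fun t => \tr (Pi t *m (S - Sigma t)))
   (fun t => \tr (Pi t *m G *m Pi t *m Sigma t)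
     + \tr (Pi t *m G *m Pi t *m S)).
Proof.
move=> Pr Sc.
have Sc0 : cov_flow A b D t0 t1 (fun=> 0) (fun=> S).
  split=> [|t _]; last exact: pd_psd.
  apply: solves_ext (solves_cst t0 t1 [::] S) => t _ _.
  by rewrite mulmx0 subr0 Seq.
apply: solves_ext (duality Pr Sc Sc0 _) => t _.
  by rewrite subr0 !mul0mx mxtrace0 subr0.
by rewrite /symmetric_mx trmx0.
Qed.

Lemma potential_derive_ge t0 t1 Pi Sigma t :
  riccati A b t0 t1 Pi -> cov_flow A b D t0 t1 Pi Sigma -> t0 < t < t1 ->
  \tr (Pi t *m G *m Pi t *m Sigma t) <= \tr (Pi t *m G *m Pi t *m Sigma t)
     + \tr (Pi t *m G *m Pi t *m S).
Proof.
move=> Pr Sc /andP[tt0 tt1]; rewrite lerDl.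
by apply: psd_tr_ge0 (pd_psd Spd); apply: psd_congr => //; apply: Pr.2; rewrite !ltW.
Qed.

Lemma potential_ndecr t0 t1 Pi Sigma : t0 <= t1 ->
  riccati A b t0 t1 Pi -> cov_flow A b D t0 t1 Pi Sigma ->
  \tr (Pi t0 *m (S - Sigma t0)) <= \tr (Pi t1 *m (S - Sigma t1)).
Proof.
move=> t01 Pr Sc; apply: (solves_le (potential_solves Pr Sc) t01) => t tt _.
apply: le_trans (potential_derive_ge Pr Sc tt).
move: tt => /andP[tt0 tt1]; have tt : t0 <= t <= t1 by rewrite !ltW.
by apply: psd_tr_ge0 (Sc.2 t tt); apply: psd_congr => //; exact: Pr.2.
Qed.

(** Induction on the number of unit windows: monotonicity carries the value at [t0] to the start of
    the last window, where [observability] bounds it by the increment of the potential; the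
    increments telescope. *)
Lemma tr_costate_potential : exists2 C, 0 <= C &
  forall t0 (k : nat) Pi Sigma, riccati A b t0 (t0 + k%:R) Pi ->
    cov_flow A b D t0 (t0 + k%:R) Pi Sigma ->
  k%:R * \tr (Pi t0 *m Sigma t0 *m Pi t0 *m S) <=
  C * (\tr (Pi (t0 + k%:R) *m (S - Sigma (t0 + k%:R)))
       - \tr (Pi t0 *m (S - Sigma t0))).
Proof.
have [C C0 CP] := observability.
have trS : 0 <= \tr S.
  by have [L -> _] := pd_gram Spd; exact: frob2_ge0.
exists (C * \tr S); first by rewrite mulr_ge0.
move=> t0 k Pi Sigma; elim: k => [|k IH] Pr Sc.
  by rewrite !addr0 mul0r subrr mulr0.
have tk : t0 + k%:R <= t0 + k.+1%:R by rewrite lerD2l ler_nat.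
have tk0 : t0 <= t0 + k%:R by rewrite lerDl ler0n.
have Pr0 := riccati_sub (lexx _) tk Pr; have Sc0 := cov_flow_sub (lexx _) tk Sc.
have Pr1 := riccati_sub tk0 (lexx _) Pr; have Sc1 := cov_flow_sub tk0 (lexx _) Sc.
have h0 := IH Pr0 Sc0; have h1 := tr_costate_ndecr tk0 Pr0 Sc0.
have e : t0 + k.+1%:R = t0 + k%:R + 1 by rewrite -natr1 addrA.
rewrite e in tk Pr1 Sc1 *.
have h2 := CP _ _ _ _ _ Pr1 Sc1 (potential_solves Pr1 Sc1)
  (fun t => potential_derive_ge Pr1 Sc1).
have tt : t0 + k%:R <= t0 + k%:R <= t0 + k%:R + 1 by rewrite lexx.
have h3 := psd_tr_le (psd_congr (Pr1.2 _ tt) (Sc1.2 _ tt)) (pd_psd Spd).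
have h4 := ler_wpM2r trS h2.
by rewrite -natr1 mulrDl mul1r; lra.
Qed.

End equilibrium.
End uniform_bounds.

(** * Covariance estimates on compact time intervals *)

Lemma frob2_coupling_le (R : realType) n (G Pi Sigma : 'M[R]_n) :
  symmetric_mx Pi -> psd_mx Sigma ->
  frob2 (G *m Pi *m Sigma) <= frob2 G * \tr (Pi *m Sigma *m Pi) * \tr Sigma.
Proof.
move=> Ps /psd_gram[L ->].
have -> : \tr (Pi *m (L *m L^T) *m Pi) = frob2 (Pi *m L).
  by rewrite /frob2 trmx_mul Ps !mulmxA.
rewrite -[\tr _]/(frob2 L) mulmxA -mulrA.
apply: le_trans (frob2M _ _) _; rewrite frob2T mulrA ler_wpM2r ?frob2_ge0//.
by rewrite -mulmxA frob2M.
Qed.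

(** With [Sigma = Ks Ks^T] the feedback acts through [Pi Ks], whose squared norm [\tr (Pi Sigma Pi)]
    is at most 1. It thus adds [frob2 (b *m b^T)] to the forcing, and Young's inequality on drift
    and feedback gives the rate. *)
Lemma cov_flow_tr_le (R : realType) n m (A : 'M[R]_n) (b : 'M[R]_(n, m))
    (D : 'M[R]_n) t1 Pi Sigma : 0 <= t1 -> psd_mx D ->
  riccati A b 0 t1 Pi -> cov_flow A b D 0 t1 Pi Sigma ->
  (forall t, 0 <= t <= t1 -> \tr (Pi t *m Sigma t *m Pi t) <= 1) ->
  \tr (Sigma t1) <= expR ((frob2 A + 2) * t1) *
    (\tr (Sigma 0) + (\tr D + frob2 (b *m b^T)) * t1).
Proof.
move=> t1_ge0 Dpsd Pr Sc M1.
have l0 : 0 <= frob2 A + 2 by have := frob2_ge0 A; lra.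
have := gronwall t1_ge0 l0 (solves_mxtrace Sc.1)
  (solves_linear 0 t1 (\tr D + frob2 (b *m b^T)) [::]).
rewrite mulr0 !subr0; apply => t /andP[t_gt0 tt1] _.
have tt : 0 <= t <= t1 by rewrite !ltW.
have [L DL] := psd_gram Dpsd.
split; first by rewrite addr_ge0 ?frob2_ge0// DL frob2_ge0.
have [Ks SL] := psd_gram (Sc.2 t tt); have Ps : (Pi t)^T = Pi t := Pr.2 t tt.
have := M1 t tt.
have -> : \tr (Pi t *m Sigma t *m Pi t) = frob2 (Pi t *m Ks).
  by rewrite /frob2 trmx_mul Ps SL !mulmxA.
have GPS : \tr ((A - b *m b^T *m Pi t) *m Sigma t +
    Sigma t *m (A - b *m b^T *m Pi t)^T + D) =
    2 * \tr (A *m Ks *m Ks^T) + 2 * \tr (- (b *m b^T *m (Pi t *m Ks)) *m Ks^T)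
    + \tr D.
  have -> : Sigma t *m (A - b *m b^T *m Pi t)^T =
      ((A - b *m b^T *m Pi t) *m Sigma t)^T.
    by rewrite [RHS]trmx_mul; congr (_ *m _); have [->] := Sc.2 t tt.
  rewrite !mxtraceD mxtrace_tr SL mulmxDl mulNmx mxtraceD mxtraceN.
  rewrite mulNmx mxtraceN !mulmxA; ring.
rewrite GPS SL -/(frob2 Ks).
have := tr_mul_trmx_le (A *m Ks) Ks.
have := tr_mul_trmx_le (- (b *m b^T *m (Pi t *m Ks))) Ks.
rewrite frob2N.
have := frob2M A Ks; have := frob2M (b *m b^T) (Pi t *m Ks).
have := frob2_ge0 (b *m b^T); nra.
Qed.

(** The difference [Z] has two drift terms and four coupling terms, the latter treated as forcing.
    Young's inequality against [Z] on all six gives the rate [2 * frob2 A + 6] and the forcing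
    [4 * e]. *)
Lemma cov_flow_diff_le (R : realType) n m (A : 'M[R]_n) (b : 'M[R]_(n, m))
    (D : 'M[R]_n) t1 e Pi Sigma Pi' Sigma' : 0 <= t1 -> 0 <= e ->
  riccati A b 0 t1 Pi -> cov_flow A b D 0 t1 Pi Sigma ->
  riccati A b 0 t1 Pi' -> cov_flow A b D 0 t1 Pi' Sigma' ->
  Sigma 0 = Sigma' 0 ->
  (forall t, 0 <= t <= t1 -> frob2 (b *m b^T *m Pi t *m Sigma t) <= e) ->
  (forall t, 0 <= t <= t1 -> frob2 (b *m b^T *m Pi' t *m Sigma' t) <= e) ->
  frob2 (Sigma t1 - Sigma' t1) <=
  expR ((2 * frob2 A + 6) * t1) * (4 * e * t1).
Proof.
move=> t1_ge0 e0 Pr Sc Pr' Sc' S0 Fe Fe'.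
have l0 : 0 <= 2 * frob2 A + 6 by have := frob2_ge0 A; lra.
have Zs := solvesB Sc.1 Sc'.1.
have := gronwall t1_ge0 l0 (solves_mxtrace (solves_mulmx Zs (solves_trmx Zs)))
  (solves_linear 0 t1 (4 * e) [::]).
rewrite S0 subrr mul0mx mxtrace0 mulr0 !subr0 add0r; apply=> t /andP[t_gt0 tt1] _.
have tt : 0 <= t <= t1 by rewrite !ltW.
split; first by rewrite mulr_ge0.
set F := b *m b^T *m Pi t *m Sigma t; set F' := b *m b^T *m Pi' t *m Sigma' t.
set Z := Sigma t - Sigma' t.
have aux P S : symmetric_mx S -> (A - b *m b^T *m P) *m S +
    S *m (A - b *m b^T *m P)^T + D =
    A *m S + S *m A^T - b *m b^T *m P *m S - (b *m b^T *m P *m S)^T + D.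
  move=> Ss.
  have -> : S *m (A - b *m b^T *m P)^T = ((A - b *m b^T *m P) *m S)^T.
    by rewrite [RHS]trmx_mul Ss.
  rewrite mulmxBl [(_ - _)^T]linearB/= [(A *m S)^T]trmx_mul Ss.
  by rewrite addrACA !addrA.
have -> : (A - b *m b^T *m Pi t) *m Sigma t +
    Sigma t *m (A - b *m b^T *m Pi t)^T + D -
    ((A - b *m b^T *m Pi' t) *m Sigma' t +
    Sigma' t *m (A - b *m b^T *m Pi' t)^T + D) =
    A *m Z + Z *m A^T + - F + (- F)^T + F' + F'^T.
  rewrite (aux _ _ (Sc.2 t tt).1) (aux _ _ (Sc'.2 t tt).1) -/F -/F' /Z.
  rewrite mulmxBr mulmxBl [(- F)^T]linearN/=; clearbody F F'; mx_abelian.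
clearbody Z; set dZ := (X in \tr (X *m _ + _)).
rewrite mxtraceD (tr_mul_trmxC Z dZ) /dZ !mulmxDl !mxtraceD -/(frob2 Z).
have := tr_mul_trmx_le (A *m Z) Z; have := tr_mul_trmx_le (Z *m A^T) Z.
have := tr_mul_trmx_le (- F) Z; have := tr_mul_trmx_le (- F)^T Z.
have := tr_mul_trmx_le F' Z; have := tr_mul_trmx_le F'^T Z.
have := frob2M A Z; have := frob2M Z A^T; have := Fe t tt; have := Fe' t tt.
rewrite -/F -/F' !frob2T !frob2N. lra.
Qed.

(** * Asymptotics of the family *)

(** The weight 1/8 lets two such terms be absorbed by [frob2 L] in [limit_equilibrium]. *)
Lemma tr_mul_trmx_young (R : realType) m n (X Y : 'M[R]_(m, n)) :
  \tr (X *m Y^T) <= 2 * frob2 X + frob2 Y / 8.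
Proof.
have := tr_mul_trmx_le (4 *: X) Y; rewrite /frob2 linearZ/= -!scalemxAl.
rewrite -scalemxAr !mxtraceZ; lra.
Qed.

Section steering_family.
Context (R : realType) (n m : nat).
Variables (A : 'M[R]_n) (b : 'M[R]_(n, m)) (D S Sigma0 Sigmaf : 'M[R]_n).
Variables (Sigma Pi : R -> R -> 'M[R]_n).
Hypothesis Dpsd : psd_mx D.
Hypothesis Ab : forall x0 x1, exists c, steers A b x0 x1 c.
Hypothesis Spd : pd_mx S.
Hypothesis Seq : A *m S + S *m A^T + D = 0.
Hypothesis S0pd : pd_mx Sigma0.
Hypothesis fam : forall T, 0 < T ->
  [/\ riccati A b 0 T (Pi T), cov_flow A b D 0 T (Pi T) (Sigma T),
      Sigma T 0 = Sigma0 & Sigma T T = Sigmaf].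
Let G := b *m b^T.
Let M T t := Pi T t *m Sigma T t *m Pi T t.

(** At [T - 1], split [S - Sigma] as [S - Sigma0 + (Sigma0 - Sigma)]: the Riccati bounds on the
    windows after and before [T - 1] handle [S] and [Sigma0], and the horizon 1 competitor, going
    from [Sigma0] to [Sigmaf], handles the rest. At time 0 Young's inequality leaves
    [frob2 (Pi T 0)]. *)
Lemma potential_range_bounded : exists c, forall T, 2 <= T ->
  \tr (Pi T (T - 1) *m (S - Sigma T (T - 1))) - \tr (Pi T 0 *m (S - Sigma T 0))
  <= c + frob2 (Pi T 0).
Proof.
have [r1 v1 i1 f1] := fam ltr01.
have [c1 c1P] := energy_bounded r1 v1.
have [L SL] := psd_gram (pd_psd Spd); have [K S0K] := psd_gram (pd_psd S0pd).
have [c2 c2P] := riccati_upper_bound Ab L.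
have [c3 c3P] := riccati_lower_bound Ab K.
exists (c1 + c2 + c3 + frob2 (Sigma0 - S)) => T T2.
have [|rT vT iT fT] := fam (_ : 0 < T); first by lra.
have T10 : 0 <= T - 1 by lra.
have T20 : 0 <= T - 1 - 1 by lra.
have T1 : T - 1 + 1 = T by rewrite subrK.
have rT1 : riccati A b (T - 1) (T - 1 + 1) (Pi T).
  by rewrite T1; exact: riccati_sub rT.
have vT1 : cov_flow A b D (T - 1) (T - 1 + 1) (Pi T) (Sigma T).
  by rewrite T1; exact: cov_flow_sub vT.
have rT2 : riccati A b (T - 1 - 1) (T - 1 - 1 + 1) (Pi T).
  by apply: riccati_sub rT => //; lra.
have h1 : \tr (Pi T (T - 1) *m (Sigma 1 0 - Sigma T (T - 1))) <= c1.
  by apply: (competitor_bound rT1 vT1 r1 v1) c1P; rewrite f1 T1 fT.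
have h2 := c2P _ _ rT1; have h3 := c3P _ _ rT2.
rewrite -SL in h2; rewrite subrK -S0K in h3; rewrite i1 in h1.
have PiT0 : (Pi T 0)^T = Pi T 0 by apply: rT.2; rewrite lexx; lra.
have := tr_mul_trmx_le (Sigma0 - S) (Pi T 0).
rewrite PiT0 mxtrace_mulC iT; move: h1 h2 h3.
rewrite !mulmxDr !mulmxN !mxtraceD !mxtraceN.
have := frob2_ge0 (Sigma0 - S); have := frob2_ge0 (Pi T 0); lra.
Qed.

Lemma costate_small tau e : 0 <= tau -> 0 < e ->
  exists T0, forall T, T0 <= T -> forall t, 0 <= t <= tau -> \tr (M T t) <= e.
Proof.
move=> tau0 e0.
have [C C0 CP] := tr_costate_potential Dpsd Ab Spd Seq.
have [k1 k10 k1P] := pd_frob2_le S0pd.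
have [k2 k20 k2P] := pd_frob2_le Spd.
have trM N : psd_mx N -> \tr N <= k2 * \tr (N *m S).
  move=> /psd_gram[L ->]; have := k2P _ L.
  by rewrite mxtrace_mulC mulmxA.
have [c cP] := potential_range_bounded.
(* Exceeding [C * k1 * k2] lets [N] absorb the term in [frob2 (Pi T 0)]; the last summand brings the
   remaining quotient below [e]. *)
pose x := C * k1 * k2 + 1 + k2 * C * `|c| / e.
have x0 : 0 <= x by rewrite /x; do !apply: addr_ge0 => //;
  rewrite ?mulr_ge0 ?invr_ge0// ltW.
pose N := Num.bound x; have xN : x < N%:R by exact: archi_boundP.
(* Room for [N] unit windows between [t] and [T - 1], with [T] at least 2. *)
exists (tau + N%:R + 2) => T TT t /[dup] tt /andP[t0 ttau].
have N0 : 0 <= N%:R :> R by rewrite ler0n.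
have [|rT vT iT fT] := fam (_ : 0 < T); first by lra.
have tNT : t + N%:R <= T - 1 by lra.
have tN : t <= t + N%:R by lra.
have T1T : T - 1 <= T by lra.
have tT : t <= T by lra.
have T2 : 2 <= T by lra.
have tNTT := le_trans tNT T1T.
have tN0 := le_trans t0 tN.
have h1 := CP t N _ _ (riccati_sub t0 tNTT rT) (cov_flow_sub t0 tNTT vT).
(* Monotonicity enlarges the increment over [[t, t + N]] to the one over [[0, T - 1]]. *)
have h2 := potential_ndecr Spd Seq tNT (riccati_sub tN0 T1T rT)
  (cov_flow_sub tN0 T1T vT).
have h3 := potential_ndecr Spd Seq t0 (riccati_sub (lexx _) tT rT)
  (cov_flow_sub (lexx _) tT vT).
have h4 := tr_costate_ndecr Dpsd Spd Seq t0 (riccati_sub (lexx _) tT rT)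
  (cov_flow_sub (lexx _) tT vT).
have zT : (0 : R) <= 0 <= T by rewrite lexx; lra.
have tT' : 0 <= t <= T by rewrite t0.
have h5 := cP T T2.
have h6 := k1P _ (Pi T 0).
have h7 := trM _ (psd_congr (rT.2 _ zT) (vT.2 _ zT)).
have h8 := trM _ (psd_congr (rT.2 _ tT') (vT.2 _ tT')).
rewrite [(Pi T 0)^T](rT.2 _ zT) -iT in h6.
move: h1 h2 h3 h4 h5 h6 h7 h8; rewrite -/(M T t) -/(M T 0).
set a0 := \tr (M T 0 *m S); set a := \tr (M T t *m S).
set V1 := \tr (_ *m (S - Sigma T (t + _))).
set V2 := \tr (_ *m (S - Sigma T (T - 1))).
set V3 := \tr (_ *m (S - Sigma T t)).
set V4 := \tr (_ *m (S - Sigma T 0)).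
move=> h1 h2 h3 h4 h5 h6 h7 h8.
have Pa : frob2 (Pi T 0) <= k1 * k2 * a.
  apply: le_trans h6 _; rewrite -mulrA ler_wpM2l//.
  by apply: le_trans h7 _; rewrite ler_wpM2l.
have Na : N%:R * a <= C * (`|c| + k1 * k2 * a).
  apply: le_trans h1 _; rewrite ler_wpM2l//; have := ler_norm c; lra.
have yN : 0 < N%:R - C * k1 * k2.
  have : 0 <= k2 * C * `|c| / e by rewrite !mulr_ge0 ?invr_ge0// ltW.
  by move: xN; rewrite /x; lra.
have ce : k2 * C * `|c| <= e * (N%:R - C * k1 * k2).
  rewrite -ler_pdivrMl// mulrC; move: xN; rewrite /x; lra.
rewrite -(ler_pM2r yN); apply: le_trans ce.
apply: (@le_trans _ _ (k2 * a * (N%:R - C * k1 * k2))).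
  by rewrite ler_wpM2r// ltW.
have := ler_wpM2l k20 Na; lra.
Qed.

(** The covariance at time 0 is the fixed positive definite [Sigma0], so [M T 0] controls [Pi T 0]
    with a constant independent of [T]. *)
Lemma costate0_small e : 0 < e ->
  exists T0, forall T, T0 <= T -> frob2 (Pi T 0) <= e.
Proof.
move=> e0; have [k1 k10 k1P] := pd_frob2_le S0pd.
have k1e : 0 < e / (k1 + 1) by rewrite divr_gt0//; lra.
have [T0 T0P] := costate_small (lexx 0) k1e.
exists (Num.max 1 T0) => T; rewrite ge_max => /andP[T1 TT0].
have [|rT vT iT fT] := fam (_ : 0 < T); first by lra.
have P0 : (Pi T 0)^T = Pi T 0 by apply: rT.2; rewrite lexx; lra.
apply: le_trans (k1P _ _) _; rewrite P0 -iT.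
have := T0P T TT0 0; rewrite lexx => /(_ isT); rewrite -/(M T 0).
rewrite ler_pdivlMr; last by lra.
have M0 : 0 <= \tr (M T 0).
  rewrite /M; have [|L ->] := @psd_gram _ _ (Sigma T 0).
    by apply: vT.2; rewrite lexx; lra.
  by rewrite -{2}P0 !mulmxA -mulmxA -trmx_mul; exact: frob2_ge0.
by rewrite mulrC; lra.
Qed.

(** [costate_small] is used twice: the threshold 1 bounds the covariance trace by [c] on [[0, tau]],
    and a threshold scaled by [c] then makes the coupling small. *)
Lemma coupling_small tau e : 0 <= tau -> 0 < e ->
  exists T0, forall T, T0 <= T -> forall t, 0 <= t <= tau ->
    frob2 (G *m Pi T t *m Sigma T t) <= e.
Proof.
move=> tau0 e0.
have [T1 T1P] := costate_small tau0 ltr01.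
pose c := expR ((frob2 A + 2) * tau) * (\tr Sigma0 + (\tr D + frob2 G) * tau).
have trS0 : 0 <= \tr Sigma0 by have [L -> _] := pd_gram S0pd; exact: frob2_ge0.
have trD : 0 <= \tr D by have [L ->] := psd_gram Dpsd; exact: frob2_ge0.
have c0 : 0 <= c.
  by rewrite mulr_ge0 ?expR_ge0// addr_ge0// mulr_ge0// addr_ge0// frob2_ge0.
have Gc0 : 0 <= frob2 G * c by rewrite mulr_ge0// frob2_ge0.
have ec : 0 < e / (frob2 G * c + 1) by rewrite divr_gt0//; lra.
have [T2 T2P] := costate_small tau0 ec.
exists (Num.max (tau + 1) (Num.max T1 T2)) => T.
rewrite !ge_max => /and3P[TT TT1 TT2] t /[dup] tt /andP[t0 ttau].
have [|rT vT iT fT] := fam (_ : 0 < T); first by lra.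
have tT : t <= T by lra.
have tT' : 0 <= t <= T by rewrite t0.
apply: le_trans (frob2_coupling_le _ (rT.2 t tT') (vT.2 t tT')) _.
have trS : \tr (Sigma T t) <= c.
  apply: le_trans (cov_flow_tr_le t0 Dpsd (riccati_sub (lexx _) tT rT)
    (cov_flow_sub (lexx _) tT vT) _) _.
    by move=> s /andP[s0 st]; apply: T1P => //; rewrite s0 (le_trans st).
  have A0 := frob2_ge0 A; have G0 := frob2_ge0 (b *m b^T).
  rewrite iT ler_pM ?expR_ge0//.
  - by rewrite addr_ge0// mulr_ge0// addr_ge0.
  - by rewrite ler_expR ler_wpM2l//; lra.
  - by rewrite lerD2l ler_wpM2l// addr_ge0.
have trS_ge0 : 0 <= \tr (Sigma T t).
  by have [L ->] := psd_gram (vT.2 t tT'); exact: frob2_ge0.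
have := T2P T TT2 t tt; rewrite -/(M T t) ler_pdivlMr; last by lra.
have trM0 : 0 <= \tr (M T t).
  have [L SL] := psd_gram (psd_congr (rT.2 t tT') (vT.2 t tT')).
  by rewrite /M SL; exact: frob2_ge0.
have G0 := frob2_ge0 G.
have := ler_wpM2l (mulr_ge0 G0 trM0) trS; lra.
Qed.

Lemma covariance_cauchy tau e : 0 <= tau -> 0 < e ->
  exists T0, forall T T', T0 <= T -> T0 <= T' -> forall t, 0 <= t <= tau ->
    frob2 (Sigma T t - Sigma T' t) <= e.
Proof.
move=> tau0 e0; pose c := expR ((2 * frob2 A + 6) * tau).
have c0 : 0 < c by exact: expR_gt0.
have ec : 0 < e / (c * (4 * tau) + 1).
  by rewrite divr_gt0// ltr_wpDl// !mulr_ge0// ltW.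
have [T0 T0P] := coupling_small tau0 ec.
exists (Num.max (tau + 1) T0) => T T'; rewrite !ge_max.
move=> /andP[TT TT0] /andP[TT' TT0'] t /andP[t0 ttau].
have [|rT vT iT fT] := fam (_ : 0 < T); first by lra.
have [|rT' vT' iT' fT'] := fam (_ : 0 < T'); first by lra.
have tT : t <= T by lra.
have tT' : t <= T' by lra.
apply: le_trans (cov_flow_diff_le t0 (ltW ec) (riccati_sub (lexx _) tT rT)
  (cov_flow_sub (lexx _) tT vT) (riccati_sub (lexx _) tT' rT')
  (cov_flow_sub (lexx _) tT' vT') _ _ _) _.
- by rewrite iT iT'.
- by move=> s /andP[s0 st]; apply: T0P => //; rewrite s0 (le_trans st).
- by move=> s /andP[s0 st]; apply: T0P => //; rewrite s0 (le_trans st).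
have A0 := frob2_ge0 A.
apply: (@le_trans _ _ (c * (4 * (e / (c * (4 * tau) + 1)) * tau))).
  rewrite ler_pM ?expR_ge0//.
  - by rewrite mulr_ge0// mulr_ge0// ltW.
  - by rewrite ler_expR ler_wpM2l//; lra.
  - by rewrite ler_wpM2l// mulr_ge0// ltW.
have d0 : 0 < c * (4 * tau) + 1 by rewrite ltr_wpDl// mulr_ge0 ?mulr_ge0// ltW.
have -> : c * (4 * (e / (c * (4 * tau) + 1)) * tau) =
    e * (c * (4 * tau) / (c * (4 * tau) + 1)) by ring.
rewrite ler_piMr ?(ltW e0)// ler_pdivrMr// mul1r; lra.
Qed.

Section limit.
Variables (Sigma_star : R -> 'M[R]_n) (Sigma_inf : 'M[R]_n).
Hypothesis star : forall t, 0 <= t -> Sigma T t @[T --> +oo] --> Sigma_star t.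
Hypothesis inf : Sigma_star t @[t --> +oo] --> Sigma_inf.

(** The second horizon of the uniform Cauchy estimate is sent to infinity, which makes the assumed
    pointwise limit uniform. *)
Lemma covariance_unif tau e : 0 <= tau -> 0 < e ->
  exists T0, forall T, T0 <= T -> forall t, 0 <= t <= tau ->
    frob2 (Sigma T t - Sigma_star t) <= e.
Proof.
move=> tau0 e0; have [T0 T0P] := covariance_cauchy tau0 e0.
exists T0 => T TT0 t /[dup] tt /andP[t0 _].
have h : frob2 (Sigma T t - Sigma T' t) @[T' --> +oo] -->
    frob2 (Sigma T t - Sigma_star t).
  by apply: cvg_frob2; apply: cvgB; [exact: cvg_cst|exact: star].
apply: (cvgr_to_le h); near=> T'; apply: T0P => //.
Unshelve. all: by end_near. Qed.

(* A constant drift [L] on the windows [t0, t0 + 1] would survive in the limit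
   [T -> +oo], then [t0 -> +oo], where the covariance has stopped moving. *)
Lemma limit_equilibrium : A *m Sigma_inf + Sigma_inf *m A^T + D = 0.
Proof.
set L := _ + D; apply: frob2_le0; apply/ler_addgt0Pl => e e0; rewrite addr0.
pose a := frob2 A; have a0 : 0 <= a by exact: frob2_ge0.
(* The perturbation costs [140 * (a + 1) * d] and the displacement over the window [32 * d], against
   3/4 of [frob2 L]. *)
pose d := e / (400 * (a + 1)).
have d0 : 0 < d by apply: divr_gt0; lra.
have [t0 t00 t0P] : exists2 t0, 0 <= t0 &
    forall t, t0 <= t -> frob2 (Sigma_star t - Sigma_inf) <= d.
  have /cvg_frob2 : Sigma_star t - Sigma_inf @[t --> +oo] --> Sigma_inf - Sigma_inf.
    by apply: cvgB; [exact: inf|exact: cvg_cst].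
  rewrite subrr {2}/frob2 mul0mx mxtrace0 => /cvgr_le/(_ _ d0)[t0 [_ t0P]].
  exists (Num.max 0 (t0 + 1)); first by rewrite le_max lexx.
  by move=> t; rewrite ge_max => /andP[_ tt0]; apply: t0P; lra.
have tau0 : 0 <= t0 + 1 by lra.
have [T1 T1P] := covariance_unif tau0 d0.
have [T2 T2P] := coupling_small tau0 d0.
pose T := Num.max (t0 + 2) (Num.max T1 T2).
have : T <= T by []; rewrite {1}/T !ge_max => /and3P[TT TT1 TT2].
have [|rT vT iT fT] := fam (_ : 0 < T); first by lra.
have t01 : t0 <= t0 + 1 by lra.
have t0T : t0 + 1 <= T by lra.
have close t : t0 <= t <= t0 + 1 -> frob2 (Sigma T t - Sigma_inf) <= 4 * d.
  move=> /andP[tt0 tt1]; have h1 := t0P t tt0.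
  have h2 : frob2 (Sigma T t - Sigma_star t) <= d by apply: T1P => //; apply/andP; lra.
  have := frob2D_le (Sigma T t - Sigma_star t) (Sigma_star t - Sigma_inf).
  rewrite subrKA; lra.
have LTs := solves_mxtrace (solves_mulmx (solves_sub t00 t0T vT.1)
  (solves_cst t0 (t0 + 1) [::] L^T)).
(* A lower bound for the derivative of [\tr (Sigma L^T)]: [frob2 L] less the loss 1/8 in Young's
   inequality and twice the bound [70 * (a + 1) * d] on the perturbation [N]. *)
pose kappa := frob2 L * (7 / 8) - 140 * (a + 1) * d.
have := solves_le (solvesB LTs (solves_linear t0 (t0 + 1) kappa [::])) t01.
set f0 := \tr (Sigma T t0 *m _); set f1 := \tr (Sigma T (t0 + 1) *m _) => h.
have {}h : f0 - kappa * t0 <= f1 - kappa * (t0 + 1).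
  apply: h => t /andP[tt0 tt1] _.
  have tt : t0 <= t <= t0 + 1 by rewrite !ltW.
  have tT : 0 <= t <= T by apply/andP; lra.
  rewrite mulmx0 addr0; set F := G *m Pi T t *m Sigma T t.
  have Fd : frob2 F <= d by apply: T2P => //; apply/andP; lra.
  set Z := Sigma T t - Sigma_inf.
  have -> : (A - b *m b^T *m Pi T t) *m Sigma T t +
      Sigma T t *m (A - b *m b^T *m Pi T t)^T + D =
      L + (A *m Z + Z *m A^T + - F + - F^T).
    have -> : Sigma T t *m (A - b *m b^T *m Pi T t)^T =
        ((A - b *m b^T *m Pi T t) *m Sigma T t)^T.
      by rewrite [RHS]trmx_mul (vT.2 t tT).1.
    rewrite mulmxBl [(_ - _)^T]linearB/= [(A *m _)^T]trmx_mul (vT.2 t tT).1.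
    rewrite /L /Z mulmxBr mulmxBl -/G -/F; clearbody F; mx_abelian.
  have := close t tt; rewrite -/Z; clearbody Z F => Zd.
  set N := A *m Z + _ + _ + _; rewrite mulmxDl mxtraceD -/(frob2 L).
  have := tr_mul_trmx_young (- N) L; rewrite mulNmx mxtraceN frob2N.
  have ad : 0 <= a * d by rewrite mulr_ge0// ltW.
  have : frob2 N <= 70 * (a + 1) * d.
    have := frob2D_le (A *m Z + Z *m A^T - F) (- F^T).
    have := frob2D_le (A *m Z + Z *m A^T) (- F).
    have := frob2D_le (A *m Z) (Z *m A^T).
    have := frob2M A Z; have := frob2M Z A^T; have := ler_wpM2l a0 Zd.
    rewrite !frob2N !frob2T -/a -/N; lra.
  rewrite /kappa; lra.
have E : f1 - f0 = \tr ((Sigma T (t0 + 1) - Sigma T t0) *m L^T).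
  by rewrite mulmxDl mulNmx mxtraceD mxtraceN.
have := tr_mul_trmx_young (Sigma T (t0 + 1) - Sigma T t0) L; rewrite -E.
have : frob2 (Sigma T (t0 + 1) - Sigma T t0) <= 16 * d.
  have h0 : frob2 (Sigma T t0 - Sigma_inf) <= 4 * d
    by apply: close; rewrite lexx ?t01.
  have h1 : frob2 (Sigma T (t0 + 1) - Sigma_inf) <= 4 * d
    by apply: close; rewrite lexx ?t01.
  have := frob2D_le (Sigma T (t0 + 1) - Sigma_inf) (- (Sigma T t0 - Sigma_inf)).
  rewrite frob2N opprB subrKA; lra.
have de : (a + 1) * d = e / 400 by rewrite /d; field; lra.
have da : d <= (a + 1) * d by have := mulr_ge0 a0 (ltW d0); lra.
move: h; rewrite /kappa; lra.
Qed.
End limit.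
End steering_family.

(** * Convergence from Frobenius bounds, and the theorem *)

Lemma frob2_norm_le (R : realType) m n (X : 'M[R]_(m, n)) e :
  0 <= e -> frob2 X <= e ^+ 2 -> `|X| <= e.
Proof.
move=> e0 Xe; rewrite /Num.Def.normr/= mx_normrE bigmax_le// => -[i j] _ /=.
rewrite -(@ler_pXn2r _ 2) ?nnegrE// real_normK ?num_real//.
exact: le_trans (frob2_entry X i j) Xe.
Qed.

Lemma frob2_cvg (R : realType) (T : Type) (F : set_system T) m n
    (f : T -> 'M[R]_(m, n)) (l : 'M[R]_(m, n)) : Filter F ->
  (forall e, 0 < e -> \forall x \near F, frob2 (f x - l) <= e) -> f @ F --> l.
Proof.
move=> FF fl; apply/cvgrPdist_le => e e0.
apply: filterS (fl _ (exprn_gt0 2 e0)) => x h.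
by apply: frob2_norm_le; [exact: ltW|rewrite -frob2N opprB].
Qed.

Lemma frob2_uniform_cvg (R : realType) m n (X : set R)
    (f : nat -> R -> 'M[R]_(m, n)) (l : R -> 'M[R]_(m, n)) :
  (forall e, 0 < e ->
    \forall k \near \oo, forall t, X t -> frob2 (f k t - l t) <= e) ->
  {uniform X, f @ \oo --> l}.
Proof.
move=> fl P /uniform_nbhs[E [entE EP]].
have [e /= e0 eE] : exists2 e : R, 0 < e & [set xy | ball xy.1 e xy.2] `<=` E.
  by move: entE; rewrite -entourage_ballE => -[e e0 eE]; exists e.
(* Halving turns the non-strict bound into the strict one of a ball. *)
have e20 : 0 < e / 2 by rewrite divr_gt0.
apply: filterS (fl _ (exprn_gt0 2 e20)) => k fk; apply: EP => t Xt.
apply: eE => /=; rewrite -ball_normE/=.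
apply: (@le_lt_trans _ _ (e / 2)); last by lra.
apply: frob2_norm_le; [exact: ltW|].
by rewrite -frob2N opprB; exact: fk.
Qed.

Lemma steering_bvp_flows (R : realType) n m (A : 'M[R]_n) (B b : 'M[R]_(n, m))
    (D : 'M[R]_n) (Rw : 'M[R]_m) Sigma0 Sigmaf T Sigma Pi :
  B *m invmx Rw *m B^T = b *m b^T ->
  steering_bvp A B D 0 Rw Sigma0 Sigmaf T Sigma Pi ->
  [/\ riccati A b 0 T Pi, cov_flow A b D 0 T Pi Sigma,
      Sigma 0 = Sigma0 & Sigma T = Sigmaf].
Proof.
move=> Gb; rewrite /steering_bvp Gb => -[SP [Sc Pc] Pd Sd [S0 ST]]; split=> //.
- split=> [|t /SP[]//]; split=> // t tT _.
  by apply: is_derive_eq (Pd t tT) _; rewrite oppr0 sub0r mulNmx.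
- by split=> [|t /SP[/pd_psd]//]; split=> // t tT _; exact: Sd.
Qed.

Unset Implicit Arguments.

Theorem theorem5p1 (R : realType) (n m r : nat)
    (A : 'M[R]_n) (B : 'M[R]_(n, m)) (Gamma : 'M[R]_(n, r)) (D : 'M[R]_n)
    (Q : 'M[R]_n) (Rw : 'M[R]_m) (varpi : R) (Sigma0 Sigmaf : 'M[R]_n)
    (Sigma Pi : R -> R -> 'M[R]_n)
    (hD : D = Gamma *m Gamma^T)
    (hQ : psd_mx Q)
    (hRw : pd_mx Rw)
    (hvarpi : varpi = 0)
    (hSigma0 : pd_mx Sigma0)
    (hSigmaf : pd_mx Sigmaf)
    (hneq : Sigma0 <> Sigmaf)
    (hAB : controllable A B)
    (hfam : forall tf : R, 0 < tf ->
      steering_bvp A B D Q Rw Sigma0 Sigmaf tf (Sigma tf) (Pi tf))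
    (hconv : asymptotic_point_convergence Sigma)
    (hgate : asymptotic_gateway A D Q !=set0) :
  (exists Sigma_lim : R -> 'M[R]_n,
     asymptotic_connection A D Q Sigma Sigma_lim) /\
  asymptotic_hamiltonian_zero varpi A B D Q Rw Sigma Pi.
Proof.
have [S [Spd Seq QS]] := hgate.
have Q0 : Q = 0 := psd_pd_tr_eq0 hQ Spd QS.
rewrite {}Q0 {}hvarpi in hQ hfam hgate QS *.
have [b Gb Ab] := controllable_steers hAB hRw.
have Dpsd : psd_mx D by rewrite hD; exact: gram_psd.
have fam T (T0 : 0 < T) := steering_bvp_flows Gb (hfam T T0).
have [Sigma_star [Sigma_inf [star inf infpd]]] := hconv.
split; last first.
  have Pi0 : Pi T 0 @[T --> +oo] --> (0 : 'M[R]_n).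
    apply: frob2_cvg => e e0.
    have [T0 T0P] := costate0_small Dpsd Ab Spd Seq hSigma0 fam e0.
    by near=> T; rewrite subr0; apply: T0P.
  have S0 := star 0 (lexx 0).
  rewrite /asymptotic_hamiltonian_zero /hamiltonian_at.
  (* With [Q = 0] and [varpi = 0] every remaining term contains [Pi], so continuity at the zero
     co-state suffices. *)
  have H0 : hamiltonian 0 A B D 0 Rw (Sigma_star 0) 0 = 0.
    by rewrite /hamiltonian !mul0mx !scaler0 mulr0 subrr !add0r mxtrace0 subrr.
  suff : hamiltonian 0 A B D 0 Rw (Sigma T 0) (Pi T 0) @[T --> +oo] -->
      hamiltonian 0 A B D 0 Rw (Sigma_star 0) 0 by rewrite H0.
  rewrite /hamiltonian.
  apply: cvgB.
    apply: cvgD; first exact: cvg_cst.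
    apply: cvg_mxtrace; apply: cvgD; last by do ?[exact: cvg_cst|apply: cvg_mulmx].
    by apply: cvgZ; [exact: cvg_cst|apply: cvg_mulmx => //; exact: cvg_cst].
  by apply: cvg_mxtrace; apply: cvgB; apply: cvgZ;
    do ?[exact: cvg_cst|apply: cvg_mulmx].
exists Sigma_star; split.
(* Symmetry passes to the limit: the skew part of [Sigma T t] vanishes as soon as [T] exceeds
   [t]. *)
- move=> t t0; apply/eqP; rewrite -subr_eq0; apply/eqP; apply: frob2_le0.
  have h : frob2 ((Sigma T t)^T - Sigma T t) @[T --> +oo] -->
      frob2 ((Sigma_star t)^T - Sigma_star t).
    by apply: cvg_frob2; apply: cvgB; [apply: cvg_trmx|]; exact: star.
  apply: (cvgr_to_le h); near=> T.
  have T0 : 0 < T by [].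
  have tT : t <= T by [].
  have [_ vT _ _] := fam T T0; have tT' : 0 <= t <= T by rewrite t0.
  by rewrite (vT.2 t tT').1 subrr /frob2 mul0mx mxtrace0.
- exists (fun k => k.+1%:R); split=> [k|| a c a0 ac].
  + by rewrite ltr0n.
  + apply/cvgryPge => M; near=> k.
    apply: (@le_trans _ _ k%:R); last by rewrite ler_nat.
    by near: k; exact: nbhs_infty_ger.
  + apply: frob2_uniform_cvg => e e0.
    have [T0 T0P] := covariance_unif Dpsd Ab Spd Seq hSigma0 fam star
      (le_trans a0 ac) e0.
    near=> k => t; rewrite /= in_itv/= => /andP[at_ tc].
    apply: T0P; last by rewrite (le_trans a0).
    apply: (@le_trans _ _ k%:R); last by rewrite ler_nat.
    by near: k; exact: nbhs_infty_ger.
(* The gateway is reached in infinite time at [Sigma_inf]; its trace condition holds because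
   [Q = 0]. *)
- exists +oo%E, Sigma_inf; split=> //; split=> //; last by rewrite mul0mx mxtrace0.
  have h := limit_equilibrium Dpsd Ab Spd Seq hSigma0 fam star inf. exact: h.
Unshelve. all: by end_near. Qed.
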